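(* Let $(H_{-1}(S),\mathcal{B},\mu)$ be the white noise space on the circle $S$. Then the generalized random process $$(1_{[0,t)}-t,\;x),\qquad x\in H_{-1}(S),\quad t\in[0,1],$$ is a Brownian bridge, i.e. it is a centered Gaussian process indexed by $t\in[0,1]$ with covariance function $\min(s,t)-st$.
   Context: $S=\mathbb{R}/\mathbb{Z}$ is the circle, identified with $[0,1)$; functions are real-valued; $(f,g)=\int_S f(t)\overline{g(t)}\,dt$ and $\|f\|$ are the $L^2(S)$ inner product and norm; $\psi_n(t)=e^{i2\pi nt}$, $n\in\mathbb{Z}$. $H_1(S)=\{f\in L^2(S):\sum_n n^2|(f,\psi_n)|^2<\infty\}$, $H_{1,0}(S)=\{f\in H_1(S):(f,\psi_0)=0\}$ with norm $\|f\|_{H_{1,0}(S)}^2=\sum_n n^2|(f,\psi_n)|^2$, and $H_{-1}(S)$ is the dual of $H_{1,0}(S)$, with pairing $(\xi,x)=\xi(x)$. $\mathcal{B}$ is the Borel $\sigma$-algebra on $H_{-1}(S)$ (generated by the cylinder sets). The white noise space is $(H_{-1}(S),\mathcal{B},\mu)$, where $\mu$ is the unique probability measure with $\int_{H_{-1}(S)}e^{i(x,\xi)}\,d\mu(x)=\exp(-\frac12\|\xi\|^2)$ for all $\xi\in H_{1,0}(S)$. Let $L_0^2(S)=\{f\in L^2(S):(f,\psi_0)=0\}$. For $f\in L_0^2(S)$ the random variable $(f,x)=f(x)$ is defined as the limit in $L^2(H_{-1}(S),\mathcal{B},\mu)$ of $\xi_n(x)$, for any sequence $\xi_n\in H_{1,0}(S)$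 with $\xi_n\to f$ in $L^2(S)$ (the limit exists and does not depend on the sequence). In the claim, $1_{[0,t)}-t$ is the function $u\mapsto 1_{[0,t)}(u)-t$ on $S$, which belongs to $L_0^2(S)$. *)

(* Defs.v *)
From HB Require Import structures.
From mathcomp Require Import all_boot all_order all_algebra.
From mathcomp Require Import all_classical all_reals all_analysis.
From mathcomp Require Import measurable_realfun complex ring lra.

Set Implicit Arguments.
Unset Strict Implicit.
Unset Printing Implicit Defensive.

Import Order.TTheory GRing.Theory Num.Theory.
Import numFieldNormedType.Exports.

Local Open Scope classical_set_scope.
Local Open Scope ring_scope.

Section complex_integration.
Context {R : realType}.

Definition expi (x : R) : R[i] := Complex (cos x) (sin x).

Definition cintegral {d} {T : measurableType d}
    (mu : {measure set T -> \bar R}) (f : T -> R[i]) : R[i] :=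
  Complex (\int[mu]_x complex.Re (f x)) (\int[mu]_x complex.Im (f x)).

End complex_integration.

Section circle.
Context {R : realType}.

Definition arc : set R := `[0, 1[.

Lemma measurable_arc : measurable arc.
Proof. exact: measurable_itv. Qed.

(* The circle R/Z is [0, 1[ with the restriction to [0, 1[ of the Lebesgue
   measure. Functions on the circle are represented by functions on R, whose
   values outside [0, 1[ are irrelevant (they live on a null set). *)
Definition circle_measure : {measure set (measurableTypeR R) -> \bar R} :=
  mrestr (@lebesgue_measure R) measurable_arc.

End circle.

(* Real-valued square-integrable representatives; the elements of L^2(S) are
   these up to circle_measure-almost everywhere equality. *)
Notation L2S R :=
  (LfunType (@circle_measure R) (lee1n 2 : (1 <= (2 : R)%:E)%E)).

Section sobolev.
Context {R : realType}.

Definition l2norm (f : R -> R) : R := fine 'N[circle_measure]_2%:E[EFin \o f]%E.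

Definition inner (f g : R -> R[i]) : R[i] :=
  cintegral circle_measure (fun t => f t * conjc (g t)).

Definition psi (n : int) (t : R) : R[i] := expi (2 * pi * n%:~R * t).

Definition fcoef (f : R -> R) (n : int) : R[i] :=
  inner (fun t => real_complex R (f t)) (psi n).

Definition H1_energy (f : R -> R) : \bar R :=
  \esum_(n in [set: int])
    ((n%:~R : R) ^+ 2 * ComplexField.Normc.normc (fcoef f n) ^+ 2)%:E.

Lemma psi_bounds (n : int) (t : R) :
  `|complex.Re (psi n t)| <= 1 /\ `|complex.Im (psi n t)| <= 1.
Proof.
by split; rewrite ler_norml /= ?cos_le1 ?cos_geN1 ?sin_le1 ?sin_geN1.
Qed.

Lemma fcoefE (f : R -> R) (n : int) : fcoef f n = Complex
  (\int[circle_measure]_t (f t * complex.Re (psi n t)))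
  (\int[circle_measure]_t (f t * (- complex.Im (psi n t)))).
Proof.
rewrite /fcoef /inner /cintegral; congr Complex; congr fine;
  apply: eq_integral => t _ /=; congr EFin; ring.
Qed.

Lemma circle_measure_fin : circle_measure [set: R] \is a fin_num.
Proof.
rewrite /circle_measure /= /mrestr setTI.
by rewrite lebesgue_measure_itv /= lte_fin ltr01 -EFinB.
Qed.

Lemma integrable_L2S_psi (f : L2S R) (g : R -> R) :
  measurable_fun setT g -> (forall t, `|g t| <= 1) ->
  circle_measure.-integrable setT (EFin \o (fun t => f t * g t)).
Proof.
move=> mg g1.
have fL1 : (f : R -> R) \in Lfun circle_measure 1.
  by apply: (Lfun_subset12 circle_measure_fin); exact: LfunP.
have /Lfun1_integrable fi := fL1.
apply: (le_integrable _ _ _ fi) => //.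
  by apply/measurable_EFinP; apply: measurable_funM.
move=> t _ /=; rewrite lee_fin normrM ler_piMr//.
Qed.

Lemma measurable_psi_Re (n : int) :
  measurable_fun setT (fun t : R => complex.Re (psi n t)).
Proof.
apply: (measurableT_comp (f := cos)); last exact: measurable_funM.
exact: continuous_measurable_fun (@continuous_cos R).
Qed.

Lemma measurable_psi_Im (n : int) :
  measurable_fun setT (fun t : R => complex.Im (psi n t)).
Proof.
apply: (measurableT_comp (f := sin)); last exact: measurable_funM.
exact: continuous_measurable_fun (@continuous_sin R).
Qed.

Lemma fcoef_linear (a : R) (f g : L2S R) (n : int) :
  fcoef (a *: f + g) n = real_complex R a * fcoef f n + fcoef g n.
Proof.
pose c t := complex.Re (psi n t); pose s t := - complex.Im (psi n t).
have key (h : R -> R) : measurable_fun setT h -> (forall t, `|h t| <= 1) ->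
  \int[circle_measure]_t ((a *: f + g : L2S R) t * h t) =
  a * (\int[circle_measure]_t (f t * h t)) + \int[circle_measure]_t (g t * h t).
  move=> mh h1.
  have If := integrable_L2S_psi f mh h1.
  have Ig := integrable_L2S_psi g mh h1.
  rewrite -RintegralZl// -RintegralD//; last first.
    exact: (integrableZl measurableT a If).
  apply: eq_Rintegral => t _ /=.
  change ((a * f t + g t) * h t = a * (f t * h t) + g t * h t); ring.
have mc : measurable_fun setT c by exact: measurable_psi_Re.
have ms : measurable_fun setT s.
  by apply: measurable_funN; exact: measurable_psi_Im.
have c1 t : `|c t| <= 1 by have [] := psi_bounds n t.
have s1 t : `|s t| <= 1 by rewrite normrN; have [] := psi_bounds n t.
rewrite !fcoefE (key c mc c1) (key s ms s1).
by apply/eqP; rewrite eq_complex /=; apply/andP; split; apply/eqP; ring.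
Qed.

Lemma H1_energy_linear (a : R) (f g : L2S R) :
  (H1_energy f < +oo)%E -> (H1_energy g < +oo)%E ->
  (H1_energy (a *: f + g : L2S R)%R < +oo)%E.
Proof.
move=> hf hg.
pose w (h : R -> R) (n : int) : R :=
  (n%:~R : R) ^+ 2 * ComplexField.Normc.normc (fcoef h n) ^+ 2.
have w0 h n : 0 <= w h n by rewrite mulr_ge0// ?sqr_ge0.
have wE h n : w h n = (n%:~R : R) ^+ 2 *
    (complex.Re (fcoef h n) ^+ 2 + complex.Im (fcoef h n) ^+ 2).
  rewrite /w /ComplexField.Normc.normc; case: (fcoef h n) => x y /=.
  by rewrite sqr_sqrtr// addr_ge0 ?sqr_ge0.
have EZ (b : R) h : (0 <= b)%R -> (H1_energy h < +oo)%E ->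
    (\esum_(n in [set: int]) (b * w h n)%:E < +oo)%E.
  move=> b0 hh; apply: (@le_lt_trans _ _ (b%:E * H1_energy h)%E); last first.
    by rewrite lte_mul_pinfty// lee_fin.
  apply: ge_ereal_sup => _ [X [finX _] <-].
  rewrite (_ : (\sum_(x \in X) (b * w h x)%:E =
                b%:E * \sum_(x \in X) (w h x)%:E)%E); last first.
    by rewrite ge0_mule_fsumr// => n; rewrite lee_fin.
  by rewrite lee_wpmul2l ?lee_fin//; apply: ereal_sup_ubound; exists X.
apply: (@le_lt_trans _ _ (\esum_(n in [set: int])
    ((2 * a ^+ 2 * w f n)%:E + (2 * w g n)%:E))%E); last first.
  have a0 : 0 <= 2 * a ^+ 2 by rewrite mulr_ge0// sqr_ge0.
  rewrite esumD; [|by move=> n _; rewrite lee_fin mulr_ge0..].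
  by apply: lte_add_pinfty; exact: EZ.
apply: le_esum => n _; rewrite -EFinD lee_fin.
rewrite -[leLHS]/(w _ n) !wE fcoef_linear.
case: (fcoef f n) (fcoef g n) => [x y] [u v] /=.
have -> : 2 * a ^+ 2 * (n%:~R ^+ 2 * (x ^+ 2 + y ^+ 2)) +
    2 * (n%:~R ^+ 2 * (u ^+ 2 + v ^+ 2)) =
    n%:~R ^+ 2 * (2 * (a ^+ 2 * (x ^+ 2 + y ^+ 2) + (u ^+ 2 + v ^+ 2))) by ring.
apply: ler_wpM2l; first exact: sqr_ge0.
have := sqr_ge0 (a * x - u); have := sqr_ge0 (a * y - v).
by nra.
Qed.

Lemma fcoef0 (n : int) : fcoef (0 : L2S R) n = 0.
Proof.
have := fcoef_linear (-1) 0 0 n.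
rewrite scaler0 addr0 => ->.
rewrite (_ : real_complex R (-1) = -1) ?mulN1r ?addNr//.
by rewrite -[RHS](rmorphN1 (real_complex R)).
Qed.

Lemma H1_energy0 : H1_energy (0 : L2S R) = 0%E.
Proof.
by apply: esum1 => n _; rewrite fcoef0 ComplexField.Normc.normc0 expr0n mulr0.
Qed.

Definition H1 : set (L2S R) := [set f | (H1_energy f < +oo)%E].

Definition H10_pred : {pred (L2S R)} :=
  mem [set f | H1 f /\ fcoef f 0 = 0].

Lemma H10_submod_closed : submod_closed H10_pred.
Proof.
split; first by rewrite inE; split; rewrite ?fcoef0// /H1/= H1_energy0.
move=> a f g; rewrite !inE => -[f1 f0] [g1 g0]; split.
  exact: H1_energy_linear.
by rewrite fcoef_linear f0 g0 mulr0 addr0.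
Qed.

HB.instance Definition _ :=
  GRing.isSubmodClosed.Build R (L2S R) H10_pred H10_submod_closed.

Record H10 := MkH10 { H10_val :> L2S R ; H10_valP : H10_val \in H10_pred }.

HB.instance Definition _ := [isSub for H10_val].
HB.instance Definition _ := [Choice of H10 by <:].
HB.instance Definition _ := [SubChoice_isSubLmodule of H10 by <:].

Definition H10norm (xi : H10) : R := Num.sqrt (fine (H1_energy xi)).

(* On representatives H10norm is only a seminorm. A functional that is bounded
   for it takes the same value on almost everywhere equal representatives, so
   these are exactly the continuous linear functionals on H_{1,0}(S). *)
Record Hm1 := MkHm1 {
  Hm1_fun :> {linear H10 -> R^o} ;
  Hm1_bounded : exists C : R, forall xi, `|Hm1_fun xi| <= C * H10norm xi }.

Definition pairing (x : Hm1) (xi : H10) : R := x xi.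

Lemma Hm1_zero_bounded : exists C : R, forall xi : H10,
  `|(\0%R : {linear H10 -> R^o}) xi| <= C * H10norm xi.
Proof. by exists 0 => xi; rewrite mul0r normr0. Qed.

HB.instance Definition _ := gen_eqMixin Hm1.
HB.instance Definition _ := gen_choiceMixin Hm1.
HB.instance Definition _ := isPointed.Build Hm1 (MkHm1 Hm1_zero_bounded).

Definition cylinder : set (set Hm1) :=
  [set C | exists n (xi : n.-tuple H10)
             (A : set (n.-tuple (measurableTypeR R))),
     measurable A /\ C = [set x | A (map_tuple (pairing x) xi)]].

End sobolev.
Arguments H10 : clear implicits.
Arguments Hm1 : clear implicits.

Notation whiteS R := (g_sigma_algebraType (@cylinder R)).

Section white_noise.
Context {R : realType}.

Definition is_white_noise (mu : probability (whiteS R) R) : Prop :=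
  forall xi : H10 R,
    cintegral mu (fun x => expi (pairing x xi)) =
    real_complex R (expR (- (l2norm xi ^+ 2) / 2)).

(* For f in L^2_0(S): X is a version of (f, x), which is only defined up to
   mu-almost everywhere equality. *)
Definition is_pairing (mu : probability (whiteS R) R) (f : R -> R)
    (X : {RV mu >-> R}) : Prop :=
  [/\ (X : whiteS R -> R) \in Lfun mu 2%:E &
   forall xi : nat -> H10 R,
     'N[circle_measure]_2%:E[EFin \o (fun t => (xi n t - f t)%R)]%E @[n --> \oo]
       --> 0%E ->
     'N[mu]_2%:E[EFin \o (fun x => (pairing x (xi n) - X x)%R)]%E @[n --> \oo]
       --> 0%E].

Definition bridge_fun (t u : R) : R := \1_(`[0, t[) u - t.

End white_noise.

Section gaussian.
Context {R : realType} {d} {T : measurableType d} (P : probability T R).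

(* The variance s ^+ 2 may vanish; normal_prob m 0 is a junk value. *)
Definition gaussian (Y : {RV P >-> R}) : Prop :=
  exists m s : R, forall A : set R, measurable A ->
    distribution P Y A = if s == 0 then \d_m A else normal_prob m s A.

Definition gaussian_process (I : set R) (X : R -> {RV P >-> R}) : Prop :=
  forall n (t a : 'I_n -> R), (forall i, I (t i)) ->
    gaussian (\sum_(i < n) a i *: X (t i)).

Definition brownian_bridge (X : R -> {RV P >-> R}) : Prop :=
  [/\ gaussian_process `[0, 1] X,
      forall t, t \in `[0, 1] -> ('E_P[X t] = 0)%E &
      forall s t, s \in `[0, 1] -> t \in `[0, 1] ->
        covariance P (X s) (X t) = (Num.min s t - s * t)%:E].

End gaussian.

(* Main.v *)
Require Import Defs.
From mathcomp Require Import all_boot all_order all_algebra.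
From mathcomp Require Import all_classical all_reals all_analysis.
From mathcomp Require Import measurable_realfun complex ring lra.

Set Implicit Arguments.
Unset Strict Implicit.
Unset Printing Implicit Defensive.

Import Order.TTheory GRing.Theory Num.Theory.
Import numFieldNormedType.Exports.
Local Open Scope classical_set_scope.
Local Open Scope ring_scope.

(** The map sending xi to (xi, x) is a Gaussian isometry. For xi in H_{1,0}(S)
    the defining property of the white noise, applied to all multiples of xi,
    says that (xi, x) has the characteristic function of a centred normal
    variable of variance the integral of xi^2. This property survives limits: if
    eta_n tends to g boundedly and pointwise on the open arc ]0, 1[ and (eta_n,
    x) tends to Y(x) in L^1, then Y has the characteristic function exp(- s^2
    (g, g) / 2) ([noise_limit_cf]). Such pairs (g, Y) form a vector space
    ([noise_limit_lin]), and each (1_[0,t) - t, X t) is one of them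
    ([bridge_noise_limit]). So every linear combination of the X t has a
    Gaussian characteristic function, the variables X t are centred, and by
    polarization the covariance of X s and X t is the inner product of 1_[0,s) -
    s and 1_[0,t) - t, which is min(s, t) - s t ([integral_bridge_fun_mul]).

    Three facts have to be supplied.

    There must be elements of H_{1,0}(S) converging to 1_[0,t) - t: without
    them the limit that defines X t would say nothing. The indicator is
    approached by trapezoids, and a trapezoid is a linear combination of the
    functions u |-> min(a, u) - a u - a (1 - a) / 2, that is, of the centred
    Green functions of the second derivative on the circle. Their n-th Fourier
    coefficient is (exp(- 2 i pi n a) - 1) / (2 pi n)^2
    ([green_fcoef]), so their energy is dominated by the sum of 1 / n^2.

    A law on the line must be determined by its characteristic function
    ([fourier_transform_inj]). The integrals of cos(t x) and sin(t x) determine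
    those of every polynomial in w = (1 + sin(s x)) / 2, by the product
    formulas. The polynomials (1 - w^n)^m, with m of order n c^(-n), stay in
    [0, 1] and tend to the indicator of w < c; with c = (1 + sin(s b)) / 2
    and s tending to 0, the event w < c becomes x < b. Hence the masses of
    all half lines are determined.

    The normal law must have the expected characteristic function
    ([normal_cfE]): the integral of cos(t x + a) against the density solves
    f' = - s^2 t f, by differentiation under the integral and integration by
    parts. The phase a covers cosine and sine at once.

    Means and variances are read off the characteristic function through
    n sin(Y / n), which tends to Y and is dominated by |Y|; no moment of the
    normal law is computed. *)

(** * Integration *)

Section finite_measure_integrals.
Context {d} {T : measurableType d} {R : realType}.
Variable mu : {measure set T -> \bar R}.
Hypothesis mu_fin : (mu setT < +oo)%E.

Lemma bounded_integrable (f : T -> R) (C : R) : measurable_fun setT f ->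
  (forall x, `|f x| <= C) -> mu.-integrable setT (EFin \o f).
Proof.
move=> mf fC; apply: measurable_bounded_integrable => //.
exists C; split; first exact: num_real.
by move=> M CM x _ /=; rewrite (le_trans (fC x))// ltW.
Qed.

(** Functions on the circle are bounded only on the unit interval, hence the
    almost everywhere bound; clamping f to [-C, C] reduces it to the everywhere
    bounded case. *)
Lemma ae_bounded_integrable (f : T -> R) (C : R) : measurable_fun setT f ->
  {ae mu, forall x, `|f x| <= C} -> mu.-integrable setT (EFin \o f).
Proof.
move=> mf fC.
pose g x := Num.max (- C) (Num.min C (f x)).
have fg : ae_eq mu setT (EFin \o g) (EFin \o f).
  apply: filterS fC => x /= fC _; congr EFin; rewrite /g.
  move: fC; rewrite ler_norml => /andP[Cf fC].
  by rewrite (min_idPr fC) (max_idPr Cf).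
have mg : measurable_fun setT g.
  by apply: measurable_maxr => //; apply: measurable_minr.
apply/integrableP; split; first exact/measurable_EFinP.
have gC x : `|g x| <= `|C|.
  rewrite /g ler_norml; have := ler_norm C; have := ler_norm (- C).
  rewrite normrN maxEle minEle; do 2 case: ifPn => //; lra.
have /integrableP[_] := bounded_integrable mg gC; apply: le_lt_trans.
rewrite le_eqVlt; apply/orP; left; apply/eqP.
apply: ae_eq_integral => //.
- by apply/measurableT_comp => //; exact/measurable_EFinP.
- by apply/measurableT_comp => //; exact/measurable_EFinP.
- apply: filterS fg => x fgx _; by have /= [->] := fgx I.
Qed.
End finite_measure_integrals.

Lemma probability_lty {d} {T : measurableType d} {R : realType}
  (P : probability T R) : (P setT < +oo)%E.
Proof. by rewrite probability_setT ltry. Qed.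

Section Rintegral_limits.
Context {d} {T : measurableType d} {R : realType}.
Variable mu : {measure set T -> \bar R}.

Lemma Rintegral_lin (a b : R) (f g : T -> R) :
  mu.-integrable setT (EFin \o f) -> mu.-integrable setT (EFin \o g) ->
  \int[mu]_x (a * f x + b * g x) = a * \int[mu]_x f x + b * \int[mu]_x g x.
Proof.
move=> If Ig; rewrite -RintegralZl// -[X in _ = _ + X]RintegralZl// -RintegralD//.
- exact: (integrableZl measurableT a If).
- exact: (integrableZl measurableT b Ig).
Qed.

Lemma cvg_Rintegral_dominated (f_ : nat -> T -> R) (f g : T -> R) :
  (forall n, measurable_fun setT (f_ n)) -> measurable_fun setT f ->
  {ae mu, forall x, f_ n x @[n --> \oo] --> f x} ->
  mu.-integrable setT (EFin \o g) ->
  {ae mu, forall x, forall n, `|f_ n x| <= g x} ->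
  \int[mu]_x f_ n x @[n --> \oo] --> \int[mu]_x f x.
Proof.
move=> mf_ mf ff ig fg.
have [||||| If _ Icv] := @dominated_convergence _ _ _ mu setT measurableT
  (fun n x => (f_ n x)%:E) (EFin \o f) (EFin \o g) => //.
- by move=> n; apply/measurable_EFinP.
- by apply/measurable_EFinP.
- by apply: filterS ff => x fx _; apply: cvg_EFin => //; exact: nearW.
- by apply: filterS fg => x fx n _ /=; rewrite lee_fin.
apply: fine_cvg.
rewrite fineK; last exact: (integrable_fin_num measurableT If).
exact: Icv.
Qed.

Lemma cvg_Rintegral_bounded (f_ : nat -> T -> R) (f : T -> R) (C : R) :
  (mu setT < +oo)%E ->
  (forall n, measurable_fun setT (f_ n)) -> measurable_fun setT f ->
  {ae mu, forall x, f_ n x @[n --> \oo] --> f x} ->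
  {ae mu, forall x, forall n, `|f_ n x| <= C} ->
  \int[mu]_x f_ n x @[n --> \oo] --> \int[mu]_x f x.
Proof.
move=> mufin mf_ mf ff fC; apply: (@cvg_Rintegral_dominated f_ f (cst C)) => //.
exact: (@bounded_integrable _ _ _ mu mufin _ `|C|).
Qed.
End Rintegral_limits.

Lemma Rintegral_FTC {R : realType} (F f : R -> R) (a b : R) : a <= b ->
  (forall x : R, is_derive x 1 F (f x)) -> continuous f ->
  \int[@lebesgue_measure R]_(x in `[a, b]) f x = F b - F a.
Proof.
rewrite le_eqVlt => /predU1P[<- _ _|ab dF cf].
  by rewrite set_itv1 Rintegral_set1 subrr.
rewrite /Rintegral (@continuous_FTC2 _ f F)//.
- exact: continuous_subspaceT.
- have cF : continuous F.
    by move=> x; apply/differentiable_continuous/derivable1_diffP; case: (dF x).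
  split.
  + by move=> x _; case: (dF x).
  + by apply: cvg_at_right_filter; exact: cF.
  + by apply: cvg_at_left_filter; exact: cF.
- by move=> x _; rewrite derive1E; case: (dF x).
Qed.

Lemma ler_norm_sub_derive {R : realType} (f df : R -> R) (x y : R) :
  (forall x : R, is_derive x 1 f (df x)) -> (forall x, `|df x| <= 1) ->
  `|f x - f y| <= `|x - y|.
Proof.
move=> d_f df1; wlog xy : x y / x <= y.
  move=> h; have [|/ltW] := leP x y; first exact: h.
  by move=> yx; rewrite distrC [leRHS]distrC; exact: h.
have cf : {within `[x, y], continuous f}.
  apply: continuous_subspaceT => z.
  by apply/differentiable_continuous/derivable1_diffP; case: (d_f z).
have [c _] := MVT_segment xy (fun z _ => d_f z) cf.
by move=> fE; rewrite distrC fE [leRHS]distrC normrM ler_piMl.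
Qed.

Section L2_norm.
Context {d} {T : measurableType d} {R : realType}.
Variable mu : {measure set T -> \bar R}.

Lemma Lnorm2E (f : T -> R) :
  mu.-integrable setT (EFin \o (fun x => f x ^+ 2)) ->
  'N[mu]_2%:E[EFin \o f]%E = (Num.sqrt (\int[mu]_x f x ^+ 2))%:E.
Proof.
move=> If; rewrite unlock /=.
have -> : (\int[mu]_x `|(f x)%:E| `^ 2 = \int[mu]_x (f x ^+ 2)%:E)%E.
  by apply: eq_integral => x _; rewrite /= powR_mulrn// real_normK ?num_real.
rewrite -(fineK (integrable_fin_num measurableT If)) poweR_EFin.
by rewrite -/(Rintegral _ _ _) powR12_sqrt// Rintegral_ge0// => x _; exact: sqr_ge0.
Qed.

Lemma integrable_sqr_Lfun2 (f : T -> R) : measurable_fun setT f ->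
  mu.-integrable setT (EFin \o (fun x => f x ^+ 2)) -> f \in Lfun mu 2%:E.
Proof.
move=> mf If; rewrite inE/=; apply/andP; split; rewrite inE//=.
by rewrite /finite_norm Lnorm2E// ltry.
Qed.
End L2_norm.

Section polarization.
Context {d} {T : measurableType d} {R : realType}.
Variable m : {measure set T -> \bar R}.

(** Polarization: it recovers an inner product from three square norms, both
    for random variables and for functions on the circle. *)
Lemma Rintegral_sqrD (f g : T -> R) : f \in Lfun m 2%:E -> g \in Lfun m 2%:E ->
  \int[m]_x (f x + g x) ^+ 2 =
  \int[m]_x f x ^+ 2 + 2 * \int[m]_x (f x * g x) + \int[m]_x g x ^+ 2.
Proof.
move=> f2 g2.
have If := Lfun2_integrable_sqr f2.
have Ig := Lfun2_integrable_sqr g2.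
have Ifg : m.-integrable setT (EFin \o (fun x => f x * g x)).
  by apply/Lfun1_integrable; exact: Lfun2_mul_Lfun1.
rewrite -[X in X + _ + _]mul1r -[X in _ + X]mul1r -Rintegral_lin//.
rewrite -[X in X + _]mul1r -Rintegral_lin//.
  by apply: eq_Rintegral => x _; ring.
exact: (integrableD measurableT (integrableZl measurableT _ If)
  (integrableZl measurableT _ Ifg)).
Qed.
End polarization.

(** * Affine phases *)

Section affine_phases.
Context {R : realType}.
Implicit Types w p u x y : R.

Lemma ler_norm_sub_cos (x y : R) : `|cos x - cos y| <= `|x - y|.
Proof.
apply: (@ler_norm_sub_derive _ _ (fun x => - sin x)) => z.
by rewrite normrN sin_max.
Qed.

Lemma ler_norm_sub_sin (x y : R) : `|sin x - sin y| <= `|x - y|.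
Proof. by apply: (@ler_norm_sub_derive _ _ cos) => z; exact: cos_max. Qed.

Lemma norm_sin_le (x : R) : `|sin x| <= `|x|.
Proof. by have := ler_norm_sub_sin x 0; rewrite sin0 !subr0. Qed.

Lemma continuous_affine w p : continuous (fun u : R => w * u + p).
Proof.
by move=> u; apply: cvgD; [apply: cvgM; [exact: cvg_cst|exact: cvg_id]|exact: cvg_cst].
Qed.

Lemma continuous_cos_affine w p : continuous (fun u : R => cos (w * u + p)).
Proof.
by move=> u; apply: continuous_comp; [exact: continuous_affine|exact: continuous_cos].
Qed.

Lemma continuous_sin_affine w p : continuous (fun u : R => sin (w * u + p)).
Proof.
by move=> u; apply: continuous_comp; [exact: continuous_affine|exact: continuous_sin].
Qed.

Lemma measurable_cos_affine w p : measurable_fun setT (fun u : R => cos (w * u + p)).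
Proof. exact: continuous_measurable_fun (@continuous_cos_affine w p). Qed.

Lemma measurable_sin_affine w p : measurable_fun setT (fun u : R => sin (w * u + p)).
Proof. exact: continuous_measurable_fun (@continuous_sin_affine w p). Qed.

Lemma measurable_cosM w : measurable_fun setT (fun u : R => cos (w * u)).
Proof. by have := measurable_cos_affine w 0; under eq_fun do rewrite addr0. Qed.

Lemma measurable_sinM w : measurable_fun setT (fun u : R => sin (w * u)).
Proof. by have := measurable_sin_affine w 0; under eq_fun do rewrite addr0. Qed.

Lemma is_derive_affine w p u : is_derive u 1 (fun u : R => w * u + p) w.
Proof. by apply: is_derive_eq; rewrite /GRing.scale/=; ring. Qed.

Lemma is_derive_cos_affine w p u :
  is_derive u 1 (fun u : R => cos (w * u + p)) (- w * sin (w * u + p)).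
Proof.
apply: (is_derive_eq (is_derive1_comp (is_derive_cos _) (is_derive_affine w p u))).
by rewrite /GRing.scale/=; ring.
Qed.

Lemma is_derive_sin_affine w p u :
  is_derive u 1 (fun u : R => sin (w * u + p)) (w * cos (w * u + p)).
Proof.
apply: (is_derive_eq (is_derive1_comp (is_derive_sin _) (is_derive_affine w p u))).
by rewrite /GRing.scale/=; ring.
Qed.
End affine_phases.

(** * Uniqueness of the Fourier transform of a law on the line *)

Section trigonometric_moments.
Context {R : realType}.
Variables P Q : probability (measurableTypeR R) R.
Hypothesis cosPQ : forall t : R, \int[P]_x cos (t * x) = \int[Q]_x cos (t * x).
Hypothesis sinPQ : forall t : R, \int[P]_x sin (t * x) = \int[Q]_x sin (t * x).

(** The functions f for which P and Q agree on all the products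
    f(x) cos(t x) and f(x) sin(t x). Asking this for every frequency t is what
    makes the class stable under multiplication by sin(s x). *)
Definition same_fourier (f : R -> R) := [/\ measurable_fun setT f,
  exists C, forall x, `|f x| <= C &
  forall t, \int[P]_x (f x * cos (t * x)) = \int[Q]_x (f x * cos (t * x)) /\
            \int[P]_x (f x * sin (t * x)) = \int[Q]_x (f x * sin (t * x))].

Lemma integrable_bounded_mul (S : probability (measurableTypeR R) R) (f g : R -> R) :
  measurable_fun setT f -> (exists C, forall x, `|f x| <= C) ->
  measurable_fun setT g -> (forall x, `|g x| <= 1) ->
  S.-integrable setT (EFin \o (fun x => f x * g x)).
Proof.
move=> mf [C fC] mg g1.
apply: (@bounded_integrable _ _ _ _ (probability_lty S) _ C).
  exact: measurable_funM.
move=> x; rewrite normrM (le_trans _ (fC x))// ler_piMr//.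
Qed.

Lemma same_fourier1 : same_fourier (cst 1).
Proof.
split => //; first by exists 1 => x; rewrite normr1.
move=> t; split.
  by under eq_Rintegral do rewrite /= mul1r;
     under [RHS]eq_Rintegral do rewrite /= mul1r; exact: cosPQ.
by under eq_Rintegral do rewrite /= mul1r;
   under [RHS]eq_Rintegral do rewrite /= mul1r; exact: sinPQ.
Qed.

Lemma same_fourierD (a b : R) (f g : R -> R) : same_fourier f -> same_fourier g ->
  same_fourier (fun x => a * f x + b * g x).
Proof.
move=> [mf bf ff] [mg bg fg]; split.
- by apply: measurable_funD; apply: measurable_funM.
- move: bf bg => [C fC] [D gD]; exists (`|a| * C + `|b| * D) => x.
  by rewrite (le_trans (ler_normD _ _))// !normrM lerD// ler_wpM2l.
- move=> t.
  have lin (h : R -> R) : measurable_fun setT h -> (forall x, `|h x| <= 1) ->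
      forall S : probability (measurableTypeR R) R,
      \int[S]_x ((a * f x + b * g x) * h x) =
      a * \int[S]_x (f x * h x) + b * \int[S]_x (g x * h x).
    move=> mh h1 S.
    have If := integrable_bounded_mul S mf bf mh h1.
    have Ig := integrable_bounded_mul S mg bg mh h1.
    rewrite -Rintegral_lin//.
    by apply: eq_Rintegral => x _; ring.
  have [fc fs] := ff t; have [gc gs] := fg t.
  rewrite !(lin (fun x => cos (t * x)) (measurable_cosM t))
    ?(lin (fun x => sin (t * x)) (measurable_sinM t)) ?fc ?gc ?fs ?gs//;
    by move=> x; rewrite ?cos_max ?sin_max.
Qed.

(** The product formulas shift the frequency t by s, which stays in reach
    because the class quantifies over all frequencies. *)
Lemma same_fourier_sinM (s : R) (f : R -> R) : same_fourier f ->
  same_fourier (fun x => f x * sin (s * x)).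
Proof.
move=> [mf bf ff]; split.
- by apply: measurable_funM => //; exact: measurable_sinM.
- move: bf => [C fC]; exists C => x.
  by rewrite normrM (le_trans _ (fC x))// ler_piMr// sin_max.
- move=> t.
  have I S (h : R -> R) := @integrable_bounded_mul S f h mf bf.
  have c1 u (x : R) : `|cos (u * x)| <= 1 by exact: cos_max.
  have s1 u (x : R) : `|sin (u * x)| <= 1 by exact: sin_max.
  have key (S : probability (measurableTypeR R) R) :
    \int[S]_x (f x * sin (s * x) * cos (t * x)) =
      2^-1 * (\int[S]_x (f x * sin ((t + s) * x)) -
              \int[S]_x (f x * sin ((t - s) * x))) /\
    \int[S]_x (f x * sin (s * x) * sin (t * x)) =
      2^-1 * (\int[S]_x (f x * cos ((t - s) * x)) -
              \int[S]_x (f x * cos ((t + s) * x))).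
    split; rewrite mulrBr -mulNr -Rintegral_lin.
    - by apply: eq_Rintegral => x _; rewrite !mulrDl !mulNr sinD sinB; field.
    - exact: (I _ _ (measurable_sinM _) (s1 _)).
    - exact: (I _ _ (measurable_sinM _) (s1 _)).
    - by apply: eq_Rintegral => x _; rewrite !mulrDl !mulNr cosB cosD; field.
    - exact: (I _ _ (measurable_cosM _) (c1 _)).
    - exact: (I _ _ (measurable_cosM _) (c1 _)).
  have [-> ->] := key P; have [-> ->] := key Q.
  have [-> ->] := ff (t + s); have [-> ->] := ff (t - s).
  by [].
Qed.

(** The sine rescaled to [0, 1], the interval on which the powers w^n separate
    the points below and above a threshold. *)
Definition half_sin (s x : R) : R := (1 + sin (s * x)) / 2.

Lemma same_fourier_expn_onem (s : R) (n : nat) (f : R -> R) : same_fourier f ->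
  same_fourier (fun x => f x * (1 - half_sin s x ^+ n)).
Proof.
move=> ff.
have step g : same_fourier g -> same_fourier (fun x => g x * half_sin s x).
  move=> fg; have := same_fourierD 2^-1 2^-1 fg (same_fourier_sinM s fg).
  by congr same_fourier; apply/funext => x; rewrite /half_sin; field.
have pow : same_fourier (fun x => f x * half_sin s x ^+ n).
  elim: n => [|n IH].
    by move: ff; congr same_fourier; apply/funext => x; rewrite expr0 mulr1.
  have := step _ IH.
  by congr same_fourier; apply/funext => x; rewrite exprSr mulrA.
have := same_fourierD 1 (-1) ff pow.
by congr same_fourier; apply/funext => x; ring.
Qed.

(** Each of these functions is built from 1 by finitely many products with
    1 - w^n, and the class is stable under these. *)
Lemma half_sin_kernel_integral (s : R) (n m : nat) :
  \int[P]_x (1 - half_sin s x ^+ n) ^+ m = \int[Q]_x (1 - half_sin s x ^+ n) ^+ m.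
Proof.
have : same_fourier (fun x => (1 - half_sin s x ^+ n) ^+ m).
  elim: m => [|m IH].
    by have := same_fourier1; congr same_fourier; apply/funext => x; rewrite expr0.
  have := same_fourier_expn_onem s n IH.
  by congr same_fourier; apply/funext => x; rewrite exprSr.
move=> [_ _ /(_ 0)[+ _]].
by under eq_Rintegral do rewrite mul0r cos0 mulr1;
   under [X in _ = X -> _]eq_Rintegral do rewrite mul0r cos0 mulr1.
Qed.
End trigonometric_moments.

Section indicator_limits.
Context {R : realType}.

Definition cutoff_exponent (c : R) (n : nat) : nat :=
  `|Num.ceil (n%:R / c ^+ n)|%N.

(** A polynomial in w approximating the indicator of w < c. Where w < c, the
    quantity m w^n is about n (w / c)^n and vanishes in the limit; where
    w >= c it is at least n. The factor n makes the limit 0 at w = c as well. *)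
Definition cutoff (c w : R) (n : nat) : R := (1 - w ^+ n) ^+ cutoff_exponent c n.

Lemma cutoff_exponent_ge (c : R) n : 0 < c -> n%:R / c ^+ n <= (cutoff_exponent c n)%:R.
Proof.
move=> c0; rewrite /cutoff_exponent natr_absz ger0_norm.
  exact: ceil_ge.
by rewrite ceil_ge0 (@lt_le_trans _ _ 0)// ?ltrN10// divr_ge0// exprn_ge0// ltW.
Qed.

Lemma cutoff_exponent_lt (c : R) n : 0 < c -> (cutoff_exponent c n)%:R < n%:R / c ^+ n + 1.
Proof.
move=> c0; rewrite /cutoff_exponent natr_absz ger0_norm.
  by rewrite -ltrBlDr; have := gt_pred_ceil (n%:R / c ^+ n); rewrite intrB.
by rewrite ceil_ge0 (@lt_le_trans _ _ 0)// ?ltrN10// divr_ge0// exprn_ge0// ltW.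
Qed.

Lemma bernoulli_ge (x : R) m : -1 <= x -> 1 + m%:R * x <= (1 + x) ^+ m.
Proof.
move=> x1; elim: m => [|m IH]; first by rewrite mul0r addr0 expr0.
rewrite exprS; have : (1 + x) * (1 + m%:R * x) <= (1 + x) * (1 + x) ^+ m.
  by rewrite ler_wpM2l//; lra.
apply: le_trans.
have : 0 <= m%:R * (x * x) by rewrite mulr_ge0// -expr2 sqr_ge0.
by rewrite -natr1; lra.
Qed.

Lemma cutoff01 (c w : R) n : 0 <= w <= 1 -> 0 <= cutoff c w n <= 1.
Proof.
move=> /andP[w0 w1].
have wn0 : 0 <= w ^+ n by exact: exprn_ge0.
have wn1 : w ^+ n <= 1 by exact: exprn_ile1.
by rewrite exprn_ge0 ?exprn_ile1//; lra.
Qed.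

(** With r <= q^2 < 1 the factor n is absorbed by one of the two powers of q,
    by Bernoulli's inequality for 1 / q. *)
Lemma cvg_n_geometric (r : R) : 0 <= r < 1 -> n%:R * r ^+ n @[n --> \oo] --> (0 : R).
Proof.
move=> /andP[r0 r1].
(* Any q < 1 with r <= q^2 will do; this one avoids the square root. *)
pose q := (1 + r) / 2; have q0 : 0 < q by rewrite /q; lra.
have q1 : q < 1 by rewrite /q; lra.
have rq : r <= q ^+ 2 by rewrite /q; have := sqr_ge0 (1 - r); rewrite !expr2; lra.
pose e := q^-1 - 1.
have e0 : 0 < e by rewrite subr_gt0 invf_gt1.
have bound n : n%:R * r ^+ n <= e^-1 * q ^+ n.
  apply: (@le_trans _ _ (n%:R * (q ^+ n * q ^+ n))).
    by rewrite ler_wpM2l// -exprMn -expr2 lerXn2r// nnegrE// sqr_ge0.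
  rewrite mulrA ler_wpM2r ?exprn_ge0 ?(ltW q0)//.
  have := @bernoulli_ge e n; have -> : 1 + e = q^-1 by rewrite /e; ring.
  rewrite exprVn => /(_ (le_trans (lerN10 R) (ltW e0))) h.
  have {h} : n%:R * e <= (q ^+ n)^-1 by lra.
  rewrite -ler_pdivlMr// => h.
  by rewrite -ler_pdivlMr ?exprn_gt0// mulrC.
apply: (@squeeze_cvgr _ _ _ _ (cst 0) (fun n => e^-1 * q ^+ n)).
- by apply: nearW => n; rewrite bound andbT mulr_ge0// exprn_ge0.
- exact: cvg_cst.
- by apply: cvg_geometric; rewrite ger0_norm// ltW.
Qed.

(** Below c, Bernoulli's inequality (1 - x)^m >= 1 - m x gives the limit 1;
    from c on, (1 - x)^m <= 1 / (1 + x)^m <= 1 / (1 + m x) gives the limit 0. *)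
Lemma cvg_cutoff (c w : R) : 0 < c <= 1 -> 0 <= w <= 1 ->
  cutoff c w n @[n --> \oo] --> ((w < c)%R%:R : R).
Proof.
move=> /andP[c0 c1] w01; move: (w01) => /andP[w0 w1].
have wn0 n : 0 <= w ^+ n by exact: exprn_ge0.
have wn1 n : w ^+ n <= 1 by exact: exprn_ile1.
case: (ltP w c) => wc /=.
- apply: (@squeeze_cvgr _ _ _ _ (fun n => 1 - (n%:R * (w / c) ^+ n + 1 * w ^+ n)) (cst 1)).
  + near=> n; have /andP[_ ->] := cutoff01 c n w01; rewrite andbT.
    have := @bernoulli_ge (- w ^+ n) (cutoff_exponent c n).
    rewrite lerN2 wn1 => /(_ isT); apply: le_trans.
    rewrite lerD2l mulrN lerN2.
    rewrite expr_div_n mulrCA [w ^+ n * _]mulrC -mulrDl ler_wpM2r//.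
    exact: ltW (cutoff_exponent_lt _ _).
  + rewrite -[X in _ --> X]subr0 -[X in _ - X]addr0; apply: cvgB; first exact: cvg_cst.
    apply: cvgD.
      apply: cvg_n_geometric; rewrite divr_ge0// ?(ltW c0)//=.
      by rewrite ltr_pdivrMr// mul1r.
    by apply: cvg_geometric; rewrite ger0_norm// (lt_le_trans wc).
  + exact: cvg_cst.
- apply: (@squeeze_cvgr _ _ _ _ (cst 0) (fun n => n.+1%:R^-1)).
  + near=> n; have /andP[-> _] := cutoff01 c n w01; rewrite /=.
    rewrite -[leRHS]mul1r ler_pdivlMr//.
    have h : n.+1%:R <= (1 + w ^+ n) ^+ cutoff_exponent c n.
      apply: le_trans (bernoulli_ge _ _); last by rewrite (le_trans _ (wn0 n))// lerN10.
      rewrite -natr1 addrC lerD2l.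
      apply: (@le_trans _ _ (n%:R / c ^+ n * w ^+ n)).
        rewrite -mulrA ler_peMr// mulrC ler_pdivlMr ?exprn_gt0// mul1r.
        by rewrite lerXn2r// nnegrE// ltW.
      by rewrite ler_wpM2r// cutoff_exponent_ge.
    apply: (le_trans (ler_wpM2l _ h)); first by have /andP[] := cutoff01 c n w01.
    rewrite /cutoff -exprMn exprn_ile1//.
      by rewrite mulr_ge0//; [rewrite subr_ge0|rewrite addr_ge0].
    have := sqr_ge0 (w ^+ n); rewrite expr2; lra.
  + exact: cvg_cst.
  + exact: cvg_harmonic.
Unshelve. all: by end_near.
Qed.
End indicator_limits.

Section fourier_uniqueness.
Context {R : realType}.
Variables P Q : probability (measurableTypeR R) R.
Hypothesis cosPQ : forall t : R, \int[P]_x cos (t * x) = \int[Q]_x cos (t * x).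
Hypothesis sinPQ : forall t : R, \int[P]_x sin (t * x) = \int[Q]_x sin (t * x).

Lemma half_sin01 (s x : R) : 0 <= half_sin s x <= 1.
Proof. by rewrite /half_sin; have := sin_max (s * x); rewrite ler_norml; lra. Qed.

Lemma measurable_half_sin (s : R) : measurable_fun setT (half_sin s).
Proof.
apply: measurable_funM => //; apply: measurable_funD => //; exact: measurable_sinM.
Qed.

Lemma measurable_natr_lt (f g : R -> R) : measurable_fun setT f -> measurable_fun setT g ->
  measurable_fun setT (fun x => (f x < g x)%R%:R : R).
Proof.
move=> mf mg.
rewrite (_ : (fun _ => _) = (fun x => if f x < g x then 1 else 0)); last first.
  by apply/funext => x; case: ifP.
by apply: measurable_fun_ifT => //; exact: measurable_fun_ltr.
Qed.

Lemma norm_natr_bool (b : bool) : `|b%:R : R| <= 1.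
Proof. by case: b; rewrite ?normr1 ?normr0. Qed.

Lemma half_sin_lt_integral (s c : R) : 0 <= c <= 1 ->
  \int[P]_x (half_sin s x < c)%R%:R = \int[Q]_x (half_sin s x < c)%R%:R.
Proof.
(* The cutoff needs a positive threshold; below 0 there is nothing. *)
rewrite le_eqVlt => /andP[/predU1P[<- _|c0 c1]].
  have h x : (half_sin s x < 0) = false.
    by have /andP[h _] := half_sin01 s x; rewrite ltNge h.
  by under eq_Rintegral do rewrite h; under [RHS]eq_Rintegral do rewrite h;
     rewrite !Rintegral_cst//= !mul0r.
have lim (S : probability (measurableTypeR R) R) :
    \int[S]_x cutoff c (half_sin s x) n @[n --> \oo] -->
    \int[S]_x (half_sin s x < c)%R%:R.
  apply: (@cvg_Rintegral_bounded _ _ _ S _ _ 1 (probability_lty S)).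
  - move=> n; apply: measurable_funX; apply: measurable_funB => //.
    by apply: measurable_funX; exact: measurable_half_sin.
  - by apply: measurable_natr_lt => //; exact: measurable_half_sin.
  - by apply: aeW => x; apply: cvg_cutoff; rewrite ?c0 ?half_sin01.
  - apply: aeW => x n.
    by have /andP[? ?] := cutoff01 c n (half_sin01 s x); rewrite ger0_norm.
have := lim P; under eq_fun do rewrite (half_sin_kernel_integral cosPQ sinPQ).
by move=> limP; exact: (cvg_unique _ limP (lim Q)).
Qed.

(** As soon as the scaled points x / (k + 1) and b / (k + 1) lie within a quarter period,
    where the sine is increasing, the comparison of the sines is that of x and
    b: the sequence is eventually constant. *)
Lemma cvg_half_sin_lt (b x : R) :
  (half_sin k.+1%:R^-1 x < half_sin k.+1%:R^-1 b)%R%:R @[k --> \oo] --> ((x < b)%R%:R : R).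
Proof.
apply: cvg_near_cst; near=> k.
have k0 : 0 < k.+1%:R :> R by [].
have pi2 : 1 <= pi / 2 :> R := pihalf_ge1 R.
have small (y : R) : `|y| < k.+1%:R -> k.+1%:R^-1 * y \in `[- (pi / 2), pi / 2]%R.
  move=> yk; rewrite in_itv/= -ler_norml normrM normfV (@ger0_norm R k.+1%:R)//.
  rewrite mulrC ler_pdivrMr// (le_trans (ltW yk))//.
  by rewrite ler_peMl// ler0n.
have xk : `|x| < k.+1%:R.
  apply: (@lt_trans _ _ k%:R); last by rewrite ltr_nat.
  by near: k; exact: nbhs_infty_gtr.
have bk : `|b| < k.+1%:R.
  apply: (@lt_trans _ _ k%:R); last by rewrite ltr_nat.
  by near: k; exact: nbhs_infty_gtr.
by rewrite /half_sin ltr_pM2r// ltrD2l ltr_sin ?small// ltr_pM2l// invr_gt0.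
Unshelve. all: by end_near.
Qed.

Lemma open_ray_integral (b : R) :
  \int[P]_x (x < b)%R%:R = \int[Q]_x (x < b)%R%:R.
Proof.
have lim (S : probability (measurableTypeR R) R) :
    \int[S]_x (half_sin k.+1%:R^-1 x < half_sin k.+1%:R^-1 b)%R%:R @[k --> \oo] -->
    \int[S]_x (x < b)%R%:R.
  apply: (@cvg_Rintegral_bounded _ _ _ S _ _ 1 (probability_lty S)).
  - by move=> n; apply: measurable_natr_lt; [exact: measurable_half_sin|exact: measurable_cst].
  - exact: measurable_natr_lt.
  - by apply: aeW => x; exact: cvg_half_sin_lt.
  - by apply: aeW => x n; exact: norm_natr_bool.
have := lim P; under eq_fun do rewrite (half_sin_lt_integral _ (half_sin01 _ _)).
by move=> limP; exact: (cvg_unique _ limP (lim Q)).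
Qed.

(** The open half lines are stable under intersection and generate the Borel
    sets, so their masses suffice. *)
Lemma fourier_transform_inj (A : set R) : measurable A -> P A = Q A.
Proof.
apply: (@measure_unique _ R (measurableTypeR R) (@RGenInftyO.G R)
  (fun n => `]-oo, n%:R[%classic)).
- exact: RGenInftyO.measurableE.
- move=> _ _ [x ->] [y ->]; exists (Num.min x y).
  by apply/seteqP; split => z /=; rewrite !in_itv/= lt_min => /andP.
- by move=> n; exists n%:R.
- apply/seteqP; split => // x _.
  exists (Num.bound `|x|) => //=.
  by rewrite in_itv/= (le_lt_trans (ler_norm x))// archi_boundP.
- move=> _ [b ->].
  have S_ray (S : probability (measurableTypeR R) R) :
      S `]-oo, b[%classic = (\int[S]_x (x < b)%R%:R)%:E.
    rewrite -(setIT `]-oo, b[%classic) -[LHS]integral_indic//.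
    rewrite -[LHS]fineK; last first.
      by rewrite integral_indic// fin_num_measure//; exact: measurableI.
    rewrite /Rintegral; congr (fine _)%:E; apply: eq_integral => x _.
    rewrite indicE (_ : (x \in _) = (x < b))//.
    by apply/idP/idP; rewrite in_setE/= in_itv.
  apply: (etrans (S_ray P) (etrans _ (esym (S_ray Q)))).
  by rewrite open_ray_integral.
- by move=> n; rewrite (le_lt_trans (probability_le1 _ _))// ltry.
Qed.
End fourier_uniqueness.

(** * The Fourier transform of the centred normal law *)

Section normal_characteristic_function.
Context {R : realType}.
Notation leb := (@lebesgue_measure R).
Variable s : R.
Hypothesis s0 : s != 0.

(** The density is a Radon-Nikodym derivative of the normal law with respect
    to the Lebesgue measure, and such derivatives agree almost everywhere. *)
Lemma integral_normal_prob (f : R -> \bar R) :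
  (normal_prob 0 s).-integrable setT f ->
  (\int[normal_prob 0 s]_x f x = \int[leb]_x (f x * (normal_pdf 0 s x)%:E))%E.
Proof.
move=> If; have mf := measurable_int _ If.
have dom := normal_prob_dominates (0 : R) s.
rewrite -(Radon_Nikodym_change_of_variables dom)//=.
have mp : measurable_fun setT (EFin \o normal_pdf 0 s).
  by apply/measurable_EFinP; exact: measurable_normal_pdf.
apply: ae_eq_integral => //.
- apply: emeasurable_funM => //; apply: (measurable_int leb).
- exact: emeasurable_funM.
- apply: ae_eqe_mul2l => /=.
  rewrite Radon_NikodymE /=.
  case: cid => /= h [h1 h2 h3].
  by apply: integral_ae_eq => //= E _ mE; rewrite -h3.
Qed.

Notation p := (normal_pdf (0 : R) s).

Lemma integrable_bounded_normal_pdf (f : R -> R) : measurable_fun setT f ->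
  (forall x, `|f x| <= 1) -> leb.-integrable setT (EFin \o (fun x => f x * p x)).
Proof.
move=> mf f1; apply: (le_integrable _ _ _ (integrable_normal_pdf (0 : R) s)) => //.
- apply/measurable_EFinP; apply: measurable_funM => //; exact: measurable_normal_pdf.
- by move=> x _ /=; rewrite lee_fin normrM ler_piMl.
Qed.

Lemma Rintegral_normal_prob (f : R -> R) : measurable_fun setT f ->
  (forall x, `|f x| <= 1) ->
  \int[normal_prob 0 s]_x f x = \int[leb]_x (f x * p x).
Proof.
move=> mf f1; rewrite /Rintegral integral_normal_prob//.
exact: (@bounded_integrable _ _ _ _ (probability_lty _) _ 1).
Qed.

Lemma is_derive_normal_pdf (x : R) : is_derive x 1 p (- x / s ^+ 2 * p x).
Proof.
rewrite normal_pdfE// /normal_fun.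
have h : is_derive x 1 (fun x : R => - (x - 0) ^+ 2 / (s ^+ 2 *+ 2)) (- x / s ^+ 2).
  by apply: is_derive_eq; rewrite /GRing.scale/=; field.
have h2 := is_derive1_comp (is_derive_expR _) h.
apply: (is_derive_eq (is_deriveZ (normal_peak s) h2)).
by rewrite /GRing.scale/=; ring.
Qed.

(** The first moment is dominated by a wider normal density: |x| is at most
    |s| exp(x^2 / (4 s^2)), which costs half of the exponent of the density,
    and doubling s keeps only a quarter of it. *)
Lemma ler_norm_normal_pdf (x : R) :
  `|x| * p x <= `|s| * normal_peak s / normal_peak (s *+ 2) * normal_pdf 0 (s *+ 2) x.
Proof.
have s20 : s *+ 2 != 0 by rewrite mulrn_eq0.
rewrite !normal_pdfE// mulrCA.
have -> : `|s| * normal_peak s / normal_peak (s *+ 2) *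
    (normal_peak (s *+ 2) * normal_fun 0 (s *+ 2) x) =
    normal_peak s * (`|s| * normal_fun 0 (s *+ 2) x).
  by field; rewrite gt_eqF// normal_peak_gt0.
rewrite ler_wpM2l ?normal_peak_ge0//.
rewrite /normal_fun subr0.
pose y := x ^+ 2 / (s ^+ 2 *+ 2).
have y0 : 0 <= y by rewrite divr_ge0// ?sqr_ge0// mulrn_wge0// sqr_ge0.
have -> : - x ^+ 2 / (s ^+ 2 *+ 2) = - y by rewrite /y mulNr.
have -> : - x ^+ 2 / ((s *+ 2) ^+ 2 *+ 2) = - (y / 4) by rewrite /y; field.
have h : `|x| <= `|s| * (1 + y / 2).
  have -> : y = `|x| ^+ 2 / (`|s| ^+ 2 *+ 2) by rewrite !real_normK ?num_real.
  have sp : 0 < `|s| by rewrite normr_gt0.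
  have : 0 <= `|s| * (1 - `|x| / (`|s| * 2)) ^+ 2 by rewrite mulr_ge0// sqr_ge0.
  rewrite -[X in _ -> is_true X]subr_ge0; congr (_ <= _); field.
  by rewrite gt_eqF.
have h2 : `|x| <= `|s| * expR (y / 2).
  by rewrite (le_trans h)// ler_wpM2l// expR_ge1Dx.
rewrite expRN ler_pdivrMr ?expR_gt0// -mulrA -expRD.
rewrite (le_trans h2)// ler_wpM2l// ler_expR; lra.
Qed.

Lemma integrable_idM_normal_pdf :
  leb.-integrable setT (EFin \o (fun x => `|x| * p x)).
Proof.
have I := integrableZl measurableT
  (`|s| * normal_peak s / normal_peak (s *+ 2)) (integrable_normal_pdf 0 (s *+ 2)).
apply: (le_integrable _ _ _ I) => //.
- apply/measurable_EFinP; apply: measurable_funM; last exact: measurable_normal_pdf.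
  exact: normr_measurable.
- move=> x _ /=; rewrite lee_fin ger0_norm.
    by apply: (le_trans (ler_norm_normal_pdf x)); exact: ler_norm.
  by rewrite mulr_ge0// normal_pdf_ge0.
Qed.

(** A crude decay, enough for the boundary terms of the integration by parts. *)
Lemma normal_pdf_le_inv (x : R) :
  p x <= normal_peak s * (1 + s ^+ 2 *+ 2) / (1 + x ^+ 2).
Proof.
pose y := x ^+ 2 / (s ^+ 2 *+ 2).
have ss : 0 < s ^+ 2 *+ 2 by rewrite mulrn_wgt0// exprn_even_gt0.
have y0 : 0 <= y by rewrite divr_ge0// ?sqr_ge0// ltW.
have x0 : 0 <= x ^+ 2 by exact: sqr_ge0.
rewrite normal_pdfE// /normal_fun subr0 -mulrA ler_wpM2l ?normal_peak_ge0//.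
have -> : - x ^+ 2 / (s ^+ 2 *+ 2) = - y by rewrite /y mulNr.
rewrite expRN ler_pdivlMr; last lra.
rewrite mulrC ler_pdivrMr ?expR_gt0//.
have xE : x ^+ 2 = y * (s ^+ 2 *+ 2) by rewrite /y divfK// gt_eqF.
apply: (@le_trans _ _ ((1 + s ^+ 2 *+ 2) * (1 + y))); last first.
  by rewrite ler_wpM2l ?expR_ge1Dx//; lra.
by rewrite {1}xE; lra.
Qed.

Lemma normal_pdf_even (x : R) : p (- x) = p x.
Proof. by rewrite normal_pdfE// /normal_fun !subr0 sqrrN. Qed.

Lemma cvg_normal_pdf_nat : p n.+1%:R @[n --> \oo] --> (0 : R).
Proof.
pose C := normal_peak s * (1 + s ^+ 2 *+ 2).
have C0 : 0 <= C.
  by rewrite mulr_ge0 ?normal_peak_ge0// addr_ge0// mulrn_wge0// sqr_ge0.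
apply: (@squeeze_cvgr _ _ _ _ (cst 0) (fun n => C * n.+1%:R^-1)).
- apply: nearW => n; rewrite normal_pdf_ge0/= (le_trans (normal_pdf_le_inv _))//.
  have n0 : 0 < 1 + n.+1%:R ^+ 2 :> R by rewrite (lt_le_trans ltr01)// lerDl sqr_ge0.
  rewrite -/C ler_wpM2l// lef_pV2 ?posrE//.
  rewrite (@le_trans _ _ (n.+1%:R ^+ 2))// ?lerDr//.
  by rewrite expr2 ler_peMl// ler1n.
- exact: cvg_cst.
- rewrite -[X in _ --> X](mulr0 C); apply: cvgM; first exact: cvg_cst.
  exact: cvg_harmonic.
Qed.

(** The fundamental theorem on [-n, n], passed to the limit by dominated
    convergence: an integrable derivative of a function vanishing at
    infinity along the integers has integral zero. *)
Lemma integral_derivative_eq0 (F f : R -> R) :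
  (forall x : R, is_derive x 1 F (f x)) -> continuous f ->
  leb.-integrable setT (EFin \o f) ->
  F n.+1%:R @[n --> \oo] --> (0 : R) -> F (- n.+1%:R) @[n --> \oo] --> (0 : R) ->
  \int[leb]_x f x = 0.
Proof.
move=> dF cf If Fy FNy.
have mf : measurable_fun setT f by exact: continuous_measurable_fun.
have lim : \int[leb]_(x in `[- n.+1%:R, n.+1%:R]) f x @[n --> \oo] --> \int[leb]_x f x.
  under eq_fun do rewrite Rintegral_mkcond.
  apply: (@cvg_Rintegral_dominated _ _ _ leb _ _ (fun x => `|f x|)) => //.
  - by move=> n; apply/measurable_restrict => //; exact: measurable_funTS.
  - apply: aeW => x; apply: cvg_near_cst; near=> n.
    rewrite patchE mem_set//= in_itv/= -ler_norml ltW//.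
    apply: (@lt_trans _ _ n%:R); last by rewrite ltr_nat.
    by near: n; exact: nbhs_infty_gtr.
  - exact: integrable_norm.
  - apply: aeW => x n; rewrite patchE; case: ifPn => // _.
    by rewrite normr0.
have FTC n : \int[leb]_(x in `[- n.+1%:R, n.+1%:R]) f x = F n.+1%:R - F (- n.+1%:R).
  by apply: Rintegral_FTC => //; rewrite lerNl (le_trans _ (ler0n R n.+1))// oppr_le0.
have : \int[leb]_(x in `[- n.+1%:R, n.+1%:R]) f x @[n --> \oo] --> (0 - 0 : R).
  by under eq_fun do rewrite FTC; exact: cvgB.
by rewrite subr0 => lim0; exact: (cvg_unique _ lim lim0).
Unshelve. all: by end_near.
Qed.

(** Integration by parts, written as the vanishing of the integral of the
    derivative of s^2 sin(t x + a) p(x). *)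
Lemma integral_id_sin_normal_pdf (a t : R) :
  \int[leb]_x (- x * sin (t * x + a) * p x) =
  - (s ^+ 2 * t) * \int[leb]_x (cos (t * x + a) * p x).
Proof.
pose F x := s ^+ 2 * (sin (t * x + a) * p x).
pose f x := s ^+ 2 * t * (cos (t * x + a) * p x) + 1 * (- x * sin (t * x + a) * p x).
have mp := measurable_normal_pdf (0 : R) s.
have Ic : leb.-integrable setT (EFin \o (fun x => cos (t * x + a) * p x)).
  apply: integrable_bounded_normal_pdf; first exact: measurable_cos_affine.
  by move=> x; exact: cos_max.
have Is : leb.-integrable setT (EFin \o (fun x => - x * sin (t * x + a) * p x)).
  apply: (le_integrable _ _ _ integrable_idM_normal_pdf) => //.
    apply/measurable_EFinP; apply: measurable_funM => //.
    by apply: measurable_funM; [exact: measurable_funN|exact: measurable_sin_affine].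
  move=> x _ /=; rewrite lee_fin !normrM normr_id ler_wpM2r// normrN.
  by rewrite ler_piMr// sin_max.
have dF (x : R) : is_derive x 1 F (f x).
  have h := is_deriveZ (s ^+ 2) 
    (is_deriveM (is_derive_sin_affine t a x) (is_derive_normal_pdf x)).
  by apply: (is_derive_eq h); rewrite /GRing.scale/= /f; field.
have cp := @continuous_normal_pdf R 0 s s0.
have cf : continuous f.
  move=> x; apply: cvgD; (apply: cvgM; first exact: cvg_cst).
    by apply: cvgM; [exact: continuous_cos_affine|exact: cp].
  apply: cvgM; last exact: cp.
  by apply: cvgM; [apply: cvgN; exact: cvg_id|exact: continuous_sin_affine].
have If : leb.-integrable setT (EFin \o f).
  exact: (integrableD measurableT (integrableZl measurableT _ Ic)
    (integrableZl measurableT _ Is)).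
have lim (u : nat -> R) : p (u n) @[n --> \oo] --> (0 : R) -> F (u n) @[n --> \oo] --> (0 : R).
  move=> up; apply: norm_cvg0.
  apply: (@squeeze_cvgr _ _ _ _ (cst 0) (fun n => s ^+ 2 * p (u n))).
  - apply: nearW => n; rewrite normr_ge0/= /F normrM ger0_norm ?sqr_ge0//.
    rewrite ler_wpM2l ?sqr_ge0// normrM (ger0_norm (normal_pdf_ge0 _ _ _)).
    by rewrite ler_piMl ?normal_pdf_ge0// sin_max.
  - exact: cvg_cst.
  - by rewrite -[X in _ --> X](mulr0 (s ^+ 2)); apply: cvgM => //; exact: cvg_cst.
have := integral_derivative_eq0 dF cf If (lim _ cvg_normal_pdf_nat).
rewrite /f Rintegral_lin// mul1r => h.
apply/eqP; rewrite mulNr -addr_eq0 addrC h//.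
by apply: lim; under eq_fun do rewrite normal_pdf_even; exact: cvg_normal_pdf_nat.
Qed.

(** The real part of the characteristic function, turned by the phase a: a = 0
    gives the integral of the cosine, a = - pi / 2 that of the sine. *)
Definition normal_cf (a t : R) := \int[leb]_x (cos (t * x + a) * p x).

(** The derivative in t of cos(t x + a) p(x) is dominated by |x| p(x), uniformly
    in t, which allows differentiation under the integral. *)
Lemma normal_cf_derive (a t : R) : is_derive t 1 (normal_cf a) (- (s ^+ 2 * t) * normal_cf a t).
Proof.
have I u : leb.-integrable setT (EFin \o (fun x => cos (u * x + a) * p x)).
  apply: integrable_bounded_normal_pdf; first exact: measurable_cos_affine.
  by move=> x; exact: cos_max.
have d1 (u x : R) :
    is_derive u 1 (fun v : R => cos (v * x + a) * p x) (- x * sin (u * x + a) * p x).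
  have h := is_deriveZ (p x) (is_derive_cos_affine x a u).
  have -> : (fun v : R => cos (v * x + a) * p x) =
      (p x \*: (fun v : R => cos (x * v + a))).
    by apply/funext => v; rewrite /= /GRing.scale/= mulrC (mulrC v).
  by apply: (is_derive_eq h); rewrite /GRing.scale/= mulrC (mulrC x u).
pose f (u x : R) : R := cos (u * x + a) * p x.
pose G (x : R) : R := `|x| * p x.
have inI : `]t - 1, t + 1[%classic t.
  by rewrite /= in_itv/= ltrBlDr ltrDl ltr01.
have intf (u : R) : `]t - 1, t + 1[%classic u -> leb.-integrable setT (EFin \o f u).
  by move=> _; exact: I.
have der (u y : R) : `]t - 1, t + 1[%classic u -> setT y -> derivable (f ^~ y) u 1.
  by move=> _ _; exact: ex_derive.
have G0 y : 0 <= G y by rewrite mulr_ge0// normal_pdf_ge0.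
have bnd (u y : R) : `]t - 1, t + 1[%classic u -> setT y -> `|partial1of2 f u y| <= G y.
  move=> _ _; rewrite partial1of2E derive_val normrM (ger0_norm (normal_pdf_ge0 _ _ _)).
  rewrite ler_wpM2r ?normal_pdf_ge0// normrM normrN.
  by rewrite ler_piMr// sin_max.
have D := @differentiation_under_integral _ _ _ leb f setT measurableT t _ _ inI intf der G G0
  integrable_idM_normal_pdf bnd.
have DD := @derivable_under_integral _ _ _ leb f setT measurableT t _ _ inI intf der G G0
  integrable_idM_normal_pdf bnd.
apply: DeriveDef; first exact: DD.
rewrite -derive1E D -integral_id_sin_normal_pdf.
by apply: eq_Rintegral => x _; rewrite partial1of2E derive_val.
Qed.

(** The product of the integral with exp(s^2 t^2 / 2) has derivative zero,
    and at t = 0 it is cos a because the density has mass one. *)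
Lemma normal_cfE (a t : R) : normal_cf a t = cos a * expR (- (s ^+ 2 * t ^+ 2) / 2).
Proof.
pose chi (t : R) := normal_cf a t * expR (s ^+ 2 * t ^+ 2 / 2).
have dchi (u : R) : is_derive u 1 chi 0.
  have h : is_derive u 1 (fun t : R => s ^+ 2 * t ^+ 2 / 2) (s ^+ 2 * u).
    by apply: is_derive_eq; rewrite /GRing.scale/=; field.
  have h2 := is_deriveM (normal_cf_derive a u) (is_derive1_comp (is_derive_expR _) h).
  by apply: (is_derive_eq h2); rewrite /GRing.scale/=; ring.
have : chi t = chi 0 by exact: is_derive_0_is_cst.
have cf0 : normal_cf a 0 = cos a.
  rewrite /normal_cf; under eq_Rintegral do rewrite mul0r add0r.
  rewrite RintegralZl//; last exact: integrable_normal_pdf.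
  by rewrite /Rintegral integral_normal_pdf/= mulr1.
rewrite /chi cf0 expr0n/= mulr0 mul0r expR0 mulr1 => <-.
by rewrite -(mulrA (normal_cf a t)) -expRD mulNr addrN expR0 mulr1.
Qed.

Lemma normal_prob_phase (a t : R) :
  \int[normal_prob 0 s]_x cos (t * x + a) = cos a * expR (- (s ^+ 2 * t ^+ 2) / 2).
Proof.
rewrite Rintegral_normal_prob -/(normal_cf a t) ?normal_cfE//.
  exact: measurable_cos_affine.
by move=> x; exact: cos_max.
Qed.

Lemma normal_prob_cos (t : R) :
  \int[normal_prob 0 s]_x cos (t * x) = expR (- (s ^+ 2 * t ^+ 2) / 2).
Proof.
have := normal_prob_phase 0 t; rewrite cos0 mul1r => <-.
by apply: eq_Rintegral => x _; rewrite addr0.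
Qed.

Lemma normal_prob_sin (t : R) : \int[normal_prob 0 s]_x sin (t * x) = 0.
Proof.
(* cos (x - pi / 2) = sin x, and the constant cos (- pi / 2) is 0. *)
have := normal_prob_phase (- (pi / 2)) t; rewrite cosN cos_pihalf mul0r => h; rewrite -[RHS]h.
by apply: eq_Rintegral => x _; rewrite cosBpihalf.
Qed.
End normal_characteristic_function.

(** * Random variables with a Gaussian Fourier transform *)

Section gaussian_characteristic_function.
Context {R : realType} {d} {T : measurableType d} (P : probability T R).

Lemma Rintegral_distribution (Y : {RV P >-> measurableTypeR R}) (f : R -> R) :
  measurable_fun setT f -> (forall x, `|f x| <= 1) ->
  \int[distribution P Y]_y f y = \int[P]_x f (Y x).
Proof.
move=> mf f1; rewrite /Rintegral integral_distribution//.
  exact/measurable_EFinP.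
apply: (@bounded_integrable _ _ _ P (probability_lty P) (f \o Y) 1) => //.
- have mf' : measurable_fun (T := measurableTypeR R) setT f by exact: mf.
  exact: (measurableT_comp mf' (measurable_funPT Y)).
- by move=> x /=.
Qed.

(** The deviation s is allowed to vanish, in which case Y is almost surely 0. *)
Definition has_gaussian_cf (s : R) (Y : T -> R) := forall t : R,
  \int[P]_x cos (t * Y x) = expR (- (s ^+ 2 * t ^+ 2) / 2) /\
  \int[P]_x sin (t * Y x) = 0.

(** By uniqueness the law of Y is the point mass at 0 when s = 0, and the
    normal law otherwise. *)
Lemma has_gaussian_cf_gaussian (s : R) (Y : {RV P >-> R}) :
  has_gaussian_cf s Y -> gaussian Y.
Proof.
move=> cfY; exists 0, s => A mA.
(* The same variable, valued in the line with its generated Borel structure,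
   which is the one carried by the normal law. *)
have mY : @measurable_fun _ _ T (measurableTypeR R) setT Y.
  by have h := measurable_funPT Y; move=> mT A0 mA0; exact: h mT A0 mA0.
pose Y' : {RV P >-> measurableTypeR R} :=
  @mfun_Sub _ _ T (measurableTypeR R) Y (mem_set mY).
rewrite -[LHS]/(distribution P Y' A).
have dcos t : \int[distribution P Y']_x cos (t * x) = expR (- (s ^+ 2 * t ^+ 2) / 2).
  rewrite (Rintegral_distribution _ (measurable_cosM t)); first by have [] := cfY t.
  by move=> x; exact: cos_max.
have dsin t : \int[distribution P Y']_x sin (t * x) = 0.
  rewrite (Rintegral_distribution _ (measurable_sinM t)); first by have [] := cfY t.
  by move=> x; exact: sin_max.
have [s0|s0] := eqVneq s 0.
- apply: (@fourier_transform_inj R (distribution P Y') (\d_(0 : measurableTypeR R))) => // t.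
  + rewrite dcos s0 expr0n/= mul0r oppr0 mul0r expR0.
    rewrite /Rintegral integral_dirac//=; last first.
      by apply/measurable_EFinP; exact: measurable_cosM.
    by rewrite mulr0 cos0 indicT ?mulr1 ?mulr0.
  + rewrite dsin /Rintegral integral_dirac//=; last first.
      by apply/measurable_EFinP; exact: measurable_sinM.
    by rewrite mulr0 sin0 indicT ?mulr1 ?mulr0.
- apply: (@fourier_transform_inj R (distribution P Y') (normal_prob 0 s)) => // t.
  + by rewrite dcos normal_prob_cos.
  + by rewrite dsin normal_prob_sin.
Qed.

Lemma cvg_slope0 (f : R -> R) (l : R) (u : nat -> R) :
  is_derive (0 : R) 1 f l -> f 0 = 0 -> (forall n, u n != 0) ->
  u n @[n --> \oo] --> (0 : R) -> f (u n) / u n @[n --> \oo] --> l.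
Proof.
move=> df f0 un0 u0.
have dl : h^-1 *: (f (h *: 1 + 0) - f 0) @[h --> (0 : R)^'] --> l.
  have [dff <-] := df; exact: dff.
have /cvgr_dnbhsP/(_ u)/(_ (conj un0 u0)) := dl.
apply: cvg_trans; apply: near_eq_cvg; apply: nearW => n.
by rewrite /GRing.scale/= mulr1 addr0 f0 subr0 mulrC.
Qed.

Lemma cvg_sin_scaled (y : R) :
  n.+1%:R * sin (n.+1%:R^-1 * y) @[n --> \oo] --> y.
Proof.
have [->|y0] := eqVneq y 0.
  by under eq_fun do rewrite mulr0 sin0 mulr0; exact: cvg_cst.
have ds : is_derive (0 : R) 1 sin 1 by have := is_derive_sin (0 : R); rewrite cos0.
have un0 n : n.+1%:R^-1 * y != 0 by rewrite mulf_neq0// invr_neq0// pnatr_eq0.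
have u0 : n.+1%:R^-1 * y @[n --> \oo] --> (0 : R).
  rewrite -[X in _ --> X](mul0r y); apply: cvgM; last exact: cvg_cst.
  exact: cvg_harmonic.
have h := cvg_slope0 ds (sin0 _) un0 u0.
have : sin (n.+1%:R^-1 * y) / (n.+1%:R^-1 * y) * y @[n --> \oo] --> 1 * y.
  by apply: cvgM => //; exact: cvg_cst.
rewrite mul1r; apply: cvg_trans; apply: near_eq_cvg; apply: nearW => n /=.
by field; apply/andP; split => //; rewrite addrC natr1 pnatr_eq0.
Qed.

(** n sin(Y / n) has mean zero and tends to Y, dominated by |Y|. *)
Lemma gaussian_cf_mean (s : R) (Y : T -> R) : P.-integrable setT (EFin \o Y) ->
  has_gaussian_cf s Y -> \int[P]_x Y x = 0.
Proof.
move=> IY cfY.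
have mY : measurable_fun setT Y by apply/measurable_EFinP; exact: measurable_int IY.
have msin c : measurable_fun setT (fun x => sin (c * Y x)).
  exact: (measurableT_comp (measurable_sinM c) mY).
have lim : \int[P]_x (n.+1%:R * sin (n.+1%:R^-1 * Y x)) @[n --> \oo] --> \int[P]_x Y x.
  apply: (@cvg_Rintegral_dominated _ _ _ P _ _ (fun x => `|Y x|)) => //.
  - by move=> n; exact: measurable_funM.
  - by apply: aeW => x; exact: cvg_sin_scaled.
  - exact: integrable_norm.
  - apply: aeW => x n; rewrite normrM ger0_norm//.
    rewrite (le_trans (ler_wpM2l _ (norm_sin_le _)))// normrM ger0_norm ?invr_ge0//.
    by rewrite mulrA divff ?mul1r// pnatr_eq0.
have int0 n : \int[P]_x (n.+1%:R * sin (n.+1%:R^-1 * Y x)) = 0.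
  rewrite RintegralZl//; last first.
    apply: (@bounded_integrable _ _ _ P (probability_lty P) _ 1) => // x.
    exact: sin_max.
  by have [_ ->] := cfY n.+1%:R^-1; rewrite mulr0.
move: lim; under eq_fun do rewrite int0.
by move=> lim; apply/esym; apply: (cvg_unique _ _ lim) => //; exact: cvg_cst.
Qed.

(** The mean of (n sin(Y / n))^2 is n^2 (1 - E cos(2 Y / n)) / 2, a slope at 0 of
    an exponential, and (n sin(Y / n))^2 tends to Y^2, dominated by Y^2. *)
Lemma gaussian_cf_second_moment (s : R) (Y : T -> R) :
  measurable_fun setT Y ->
  P.-integrable setT (EFin \o (fun x => Y x ^+ 2)) ->
  has_gaussian_cf s Y -> \int[P]_x Y x ^+ 2 = s ^+ 2.
Proof.
move=> mY IY cfY.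
have msin c : measurable_fun setT (fun x => sin (c * Y x)).
  exact: (measurableT_comp (measurable_sinM c) mY).
have lim : \int[P]_x (n.+1%:R * sin (n.+1%:R^-1 * Y x)) ^+ 2 @[n --> \oo] -->
    \int[P]_x Y x ^+ 2.
  apply: (@cvg_Rintegral_dominated _ _ _ P _ _ (fun x => Y x ^+ 2)) => //.
  - by move=> n; apply: measurable_funX; exact: measurable_funM.
  - exact: measurable_funX.
  - by apply: aeW => x; apply: cvgM; exact: cvg_sin_scaled.
  - apply: aeW => x n; rewrite normrX -[leRHS]real_normK ?num_real//.
    rewrite lerXn2r ?nnegrE// normrM ger0_norm//.
    rewrite (le_trans (ler_wpM2l _ (norm_sin_le _)))// normrM ger0_norm ?invr_ge0//.
    by rewrite mulrA divff ?mul1r// pnatr_eq0.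
have mcos c : measurable_fun setT (fun x => cos (c * Y x)).
  exact: (measurableT_comp (measurable_cosM c) mY).
have Icos c : P.-integrable setT (EFin \o (fun x => cos (c * Y x))).
  apply: (@bounded_integrable _ _ _ P (probability_lty P) _ 1) => // x.
  exact: cos_max.
have I1 : P.-integrable setT (EFin \o (fun x : T => 1 : R)).
  by apply: (@bounded_integrable _ _ _ P (probability_lty P) _ 1) => // x; rewrite normr1.
pose f (h : R) := expR (- (2 * s ^+ 2) * h) - 1.
have intE n : \int[P]_x (n.+1%:R * sin (n.+1%:R^-1 * Y x)) ^+ 2 =
    - 2^-1 * (f (n.+1%:R^-1 ^+ 2) / n.+1%:R^-1 ^+ 2).
  have n0 : n.+1%:R != 0 :> R by rewrite pnatr_eq0.
  have [cE _] := cfY (2 * n.+1%:R^-1).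
  transitivity (\int[P]_x (n.+1%:R ^+ 2 / 2 * 1 +
      - (n.+1%:R ^+ 2 / 2) * cos (2 * n.+1%:R^-1 * Y x))).
    apply: eq_Rintegral => x _.
    by rewrite -(mulrA 2) (mulr_natl _ 2) cos_mulr2n cos2sin2 exprMn; field.
  rewrite Rintegral_lin// cE Rintegral_cst// [X in fine X]probability_setT/= !mulr1.
  have -> : - (s ^+ 2 * (2 * n.+1%:R^-1) ^+ 2) / 2 = - (2 * s ^+ 2) * n.+1%:R^-1 ^+ 2.
    by field.
  by rewrite /f; field.
move: lim; under eq_fun do rewrite intE.
move=> lim; apply: (cvg_unique _ lim) => //.
have -> : s ^+ 2 = - 2^-1 * (- (2 * s ^+ 2)) by field.
apply: cvgM; first exact: cvg_cst.
apply: cvg_slope0.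
- have h : is_derive (0 : R) 1 (fun h : R => - (2 * s ^+ 2) * h) (- (2 * s ^+ 2)).
    by apply: is_derive_eq; rewrite /GRing.scale/=; ring.
  apply: (is_derive_eq (is_deriveB (is_derive1_comp (is_derive_expR _) h)
    (is_derive_cst (1 : R) _ _))).
  by rewrite mulr0 expR0 subr0 mul1r.
- by rewrite /f mulr0 expR0 subrr.
- by move=> n; rewrite expf_neq0// invr_neq0// pnatr_eq0.
- by rewrite -[X in _ --> X](mulr0 0); apply: cvgM; exact: cvg_harmonic.
Qed.
End gaussian_characteristic_function.

(** * The circle as a measure space *)

Section circle_integrals.
Context {R : realType}.
Notation leb := (@lebesgue_measure R).
Notation circle := (@circle_measure R).

Lemma circle_measure_lty : (circle setT < +oo)%E.
Proof. by rewrite ltey_eq circle_measure_fin. Qed.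

Lemma circle_measureE (A : set R) : circle A = leb (A `&` `[0, 1[%classic).
Proof. by []. Qed.

Lemma circle_measure_initial_arc (t : R) : 0 <= t <= 1 ->
  circle `[0, t[%classic = t%:E.
Proof.
move=> /andP[t0 t1]; rewrite circle_measureE setIidl; last first.
  by move=> x /=; rewrite /= !in_itv/= => /andP[-> /lt_le_trans ->].
rewrite lebesgue_measure_itv/= lte_fin; case: ltP => [_|t0']; first by rewrite sube0.
by congr EFin; apply/eqP; rewrite eq_le t0 t0'.
Qed.

(** The circle is modelled by [0, 1[; discarding the point 0 as well removes
    the one point where the trapezoids below do not converge. *)
Lemma ae_circle : {ae circle, forall u : R, 0 < u < 1}.
Proof.
exists (~` `]0, 1[); split.
- by apply: measurableC; exact: measurable_itv.
- rewrite circle_measureE.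
  have -> : ~` `]0, 1[ `&` `[0, 1[%classic = [set (0 : R)].
    apply/seteqP; split => [x [/= + ]|x /= ->].
      rewrite /= !in_itv/= => h /andP[x0 x1]; apply/eqP; rewrite eq_le x0 andbT.
      by rewrite leNgt; apply/negP => x0'; apply: h; rewrite x0'.
    by split; rewrite /= in_itv/= ?ltxx// lexx ltr01.
  exact: lebesgue_measure_set1.
- by move=> x /= h; apply: contra_not h; rewrite in_itv.
Qed.

Lemma circle_aeW (Q : R -> Prop) :
  (forall u : R, 0 < u < 1 -> Q u) -> {ae circle, forall u, Q u}.
Proof.
move=> h; apply: (@filterS _ _ (ae_filter_ringOfSetsType circle) _ _ _ ae_circle).
by move=> u; exact: h.
Qed.

Lemma integral_circle (f : R -> \bar R) : measurable_fun setT f ->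
  (\int[circle]_x f x = \int[leb]_(x in `[0%R, 1%R]) f x)%E.
Proof.
move=> mf.
have -> : (\int[leb]_(x in `[0%R, 1%R]) f x = \int[leb]_(x in `]0%R, 1%R[) f x)%E.
  by apply: integral_itv_bndoo; exact: measurable_funTS.
rewrite -(@eq_measure_integral _ _ _ _ leb circle); last first.
  move=> A mA A01; rewrite circle_measureE setIidl//.
  apply: subset_trans A01 _ => x /=; rewrite /= !in_itv/= => /andP[x0 ->].
  by rewrite ltW.
rewrite integral_mkcond; apply: ae_eq_integral => //.
- by apply/(measurable_restrictT _ _).1 => //; exact: measurable_funTS.
- apply: circle_aeW => x x01 _.
  by rewrite patchE mem_set//= in_itv.
Qed.

Lemma Rintegral_circle (f : R -> R) : measurable_fun setT f ->
  \int[circle]_x f x = \int[leb]_(x in `[0, 1]) f x.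
Proof. by move=> mf; rewrite /Rintegral integral_circle//; exact/measurable_EFinP. Qed.
End circle_integrals.

(** * The Green kernel of the circle as a Sobolev function *)

Section inverse_square_sum.
Context {R : realType}.

(** A telescoping majorant that serves for both halves of the sum over the
    integers. *)
Lemma esum_telescope_lty :
  (\esum_(k in [set: nat]) (6 * (k.+1%:R^-1 - k.+2%:R^-1))%:E < +oo :> \bar R)%E.
Proof.
have v0 (k : nat) : 0 <= 6 * (k.+1%:R^-1 - k.+2%:R^-1) :> R.
  by rewrite mulr_ge0// subr_ge0 lef_pV2 ?posrE// ler_nat.
rewrite -nneseries_esumT; last by move=> k; rewrite lee_fin.
apply: (@le_lt_trans _ _ 6%:E); last by rewrite ltry.
apply: lime_le; first by apply: is_cvg_nneseries => k _ _; rewrite lee_fin.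
apply: nearW => n; rewrite sumEFin lee_fin -mulr_sumr.
under eq_bigr do rewrite -opprB.
rewrite sumrN telescope_sumr// opprB invr1.
by rewrite -[leRHS]mulr1 ler_wpM2l// lerBlDr lerDl invr_ge0.
Qed.

(** The term of index 0 is 0, because the inverse of 0 is 0. *)
Lemma esum_int_inv_sqr_lty :
  (\esum_(n in [set: int]) ((n%:~R : R) ^- 2)%:E < +oo)%E.
Proof.
pose v (k : nat) : R := 6 * (k.+1%:R^-1 - k.+2%:R^-1).
have w0 (n : int) : (0 <= ((n%:~R : R) ^- 2)%:E)%E.
  by rewrite lee_fin invr_ge0 sqr_ge0.
have bound (k : nat) (y : R) : y = 0 \/ (1 <= y /\ k.+1%:R <= 2 * y) -> y ^- 2 <= v k.
  rewrite /v -[k.+2%:R]natr1; have : 0 < k.+1%:R :> R by [].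
  set K := k.+1%:R => K0.
  have -> : 6 * (K^-1 - (K + 1)^-1) = 6 / (K * (K + 1)).
    by field; apply/andP; split; rewrite gt_eqF//; lra.
  case=> [->|[y1 Ky]]; first by rewrite expr0n/= invr0 divr_ge0// mulr_ge0//; lra.
  have K1 : 1 <= K by rewrite /K ler1n.
  rewrite ler_pdivlMr; last by rewrite mulr_gt0//; lra.
  rewrite mulrC ler_pdivrMr; last by rewrite exprn_gt0//; lra.
  by rewrite expr2; nra.
rewrite (esumID (range Posz)); last by move=> n _; exact: w0.
apply: lte_add_pinfty.
- rewrite setTI esum_image; last by move=> x y _ _ [].
  apply: le_lt_trans esum_telescope_lty; apply: le_esum => k _.
  rewrite lee_fin; apply: bound.
  case: k => [|k]; [by left|right].
  rewrite -[k.+2%:R]natr1 -[_%:~R]/(k.+1%:R).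
  have k1 : 1 <= k.+1%:R :> R by rewrite ler1n.
  by split; lra.
- have -> : setT `&` ~` range Posz = range Negz.
    apply/seteqP; split => [[k|k] [_ /= h]|_ [k _ <-]]; last by split => // -[].
      by exfalso; apply: h; exists k.
    by exists k.
  rewrite esum_image; last by move=> x y _ _ [].
  apply: le_lt_trans esum_telescope_lty; apply: le_esum => k _.
  rewrite lee_fin NegzE rmorphN sqrrN/=; apply: bound; right.
  by rewrite -[(Posz k.+1)%:~R]/(k.+1%:R : R) mulr_natl mulr2n lerDl ler1n.
Qed.
End inverse_square_sum.

Section green_kernel.
Context {R : realType}.
Notation leb := (@lebesgue_measure R).
Notation circle := (@circle_measure R).

Lemma integral_affine_cos (al be w p x y : R) : w != 0 -> x <= y ->
  let G u := (al * u + be) * sin (w * u + p) / w + al * cos (w * u + p) / w ^+ 2 in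
  \int[leb]_(u in `[x, y]) ((al * u + be) * cos (w * u + p)) = G y - G x.
Proof.
move=> w0 xy G; apply: Rintegral_FTC => //; last first.
  by move=> u; apply: cvgM; [exact: continuous_affine|exact: continuous_cos_affine].
move=> u; rewrite /G.
have H := is_deriveD
  (is_deriveM (is_deriveM (is_derive_affine al be u) (is_derive_sin_affine w p u))
    (is_derive_cst w^-1 u 1))
  (is_deriveM (is_deriveM (is_derive_cst al u 1) (is_derive_cos_affine w p u))
    (is_derive_cst (w ^- 2) u 1)).
by apply: (is_derive_eq H); rewrite /GRing.scale/=; field.
Qed.

Lemma integral_affine (al be x y : R) : x <= y ->
  \int[leb]_(u in `[x, y]) (al * u + be) =
  (al * y ^+ 2 / 2 + be * y) - (al * x ^+ 2 / 2 + be * x).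
Proof.
move=> xy; have d (u : R) :
    is_derive u 1 (fun u : R => al * u ^+ 2 / 2 + be * u) (al * u + be).
  by apply: is_derive_eq; rewrite /GRing.scale/=; field.
exact: (Rintegral_FTC xy d (@continuous_affine R al be)).
Qed.

(** The mean-zero solution G of G'' = delta_0 - delta_a on the
    circle; it is the covariance min(a, u) - a u of the bridge minus its mean
    in u. *)
Definition green (a u : R) : R := Num.min a u - a * u - a * (1 - a) / 2.

Lemma greenE_le (a u : R) : u <= a -> green a u = (1 - a) * u + - (a * (1 - a) / 2).
Proof. by move=> ua; rewrite /green (min_idPr ua); ring. Qed.

Lemma greenE_ge (a u : R) : a <= u -> green a u = - a * u + (a - a * (1 - a) / 2).
Proof. by move=> au; rewrite /green (min_idPl au); ring. Qed.

Lemma continuous_green (a : R) : continuous (green a).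
Proof.
move=> u; apply: cvgB; last exact: cvg_cst.
apply: cvgB; last by apply: cvgM; [exact: cvg_cst|exact: cvg_id].
by apply: continuous_min; [exact: cvg_cst|exact: cvg_id].
Qed.

Lemma measurable_green (a : R) : measurable_fun setT (green a).
Proof. exact: continuous_measurable_fun (@continuous_green a). Qed.

(** On each side of its corner a the Green function is affine. *)
Lemma green_integral_split (a : R) (g : R -> R) : 0 <= a <= 1 -> continuous g ->
  \int[circle]_u (green a u * g u) =
  \int[leb]_(u in `[0, a]) (((1 - a) * u + - (a * (1 - a) / 2)) * g u) +
  \int[leb]_(u in `[a, 1]) ((- a * u + (a - a * (1 - a) / 2)) * g u).
Proof.
move=> /andP[a0 a1] cg.
have cgg : continuous (fun u => green a u * g u).
  by move=> u; apply: cvgM; [exact: continuous_green|exact: cg].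
have I x y : leb.-integrable `[x, y] (EFin \o (fun u => green a u * g u)).
  apply: continuous_compact_integrable; first exact: segment_compact.
  exact: continuous_subspaceT.
rewrite Rintegral_circle; last exact: continuous_measurable_fun.
have /eqP := @Rintegral_itvB R (fun u => green a u * g u) (BLeft 0) (BRight 1) a
  (I 0 1) a0 a1.
rewrite subr_eq => /eqP ->.
rewrite Rintegral_itv_obnd_cbnd; last first.
  by apply: integrableS (I a 1) => //; exact: subset_itv_oc_cc.
rewrite addrC; congr (_ + _); apply: eq_Rintegral => u; rewrite inE/= in_itv/= => /andP[u0 u1].
  by rewrite greenE_le.
by rewrite greenE_ge.
Qed.

(** The boundary terms of the two affine pieces cancel by continuity at a and by
    periodicity, and only the jumps of the slope remain, whence the factor
    1 / w^2. The phase p gives the real and imaginary parts at once. *)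
Lemma green_fourier (a w p : R) : w != 0 -> 0 <= a <= 1 ->
  cos (w + p) = cos p -> sin (w + p) = sin p ->
  \int[circle]_u (green a u * cos (w * u + p)) = (cos (w * a + p) - cos p) / w ^+ 2.
Proof.
move=> w0 a01 cw sw; have /andP[a0 a1] := a01.
rewrite green_integral_split//; last exact: continuous_cos_affine.
by rewrite !integral_affine_cos//= !(mulr0, mulr1, add0r) cw sw; field.
Qed.

Lemma green_mean0 (a : R) : 0 <= a <= 1 -> \int[circle]_u green a u = 0.
Proof.
move=> a01; have /andP[a0 a1] := a01.
transitivity (\int[circle]_u (green a u * cst 1 u)).
  by apply: eq_Rintegral => u _; rewrite mulr1.
rewrite green_integral_split//; last by move=> u; exact: cvg_cst.
under eq_Rintegral do rewrite mulr1.
under [X in _ + X]eq_Rintegral do rewrite mulr1.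
by rewrite !integral_affine//; field.
Qed.

Lemma norm_green_le (a u : R) : 0 <= a <= 1 -> 0 < u < 1 -> `|green a u| <= 2.
Proof.
move=> /andP[a0 a1] /andP[u0 u1].
have au0 : 0 <= a * u by rewrite mulr_ge0// ltW.
have au1 : a * u <= 1 by rewrite mulr_ile1// ltW.
have aa0 : 0 <= a * (1 - a) by rewrite mulr_ge0// subr_ge0.
have aa1 : a * (1 - a) <= 1 by rewrite mulr_ile1//; lra.
rewrite /green ler_norml minEle; case: ifPn; lra.
Qed.
End green_kernel.

Section green_sobolev.
Context {R : realType}.
Notation leb := (@lebesgue_measure R).
Notation circle := (@circle_measure R).

Lemma cos_sin_2pi_int (n : int) (p : R) :
  cos (2 * pi * n%:~R + p) = cos p /\ sin (2 * pi * n%:~R + p) = sin p.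
Proof.
have nat_case (k : nat) (q : R) :
    cos (2 * pi * k%:R + q) = cos q /\ sin (2 * pi * k%:R + q) = sin q.
  have -> : 2 * pi * k%:R = pi *+ 2 *+ k :> R.
    by rewrite -(mulr_natr (pi *+ 2) k) -(mulr_natr pi 2); ring.
  by rewrite addrC (periodicn (@cosD2pi R)) (periodicn (@sinD2pi R)).
case: n => k; first exact: nat_case.
have [hc hs] := nat_case k.+1 (2 * pi * (Negz k)%:~R + p).
have e : 2 * pi * k.+1%:R + (2 * pi * (Negz k)%:~R + p) = p.
  by rewrite NegzE rmorphN /= -[(Posz k.+1)%:~R]/(k.+1%:R : R); ring.
by rewrite -hc -hs e.
Qed.

Variable a : R.
Hypothesis a01 : 0 <= a <= 1.

Lemma green_Lfun : green a \in Lfun circle 2%:E.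
Proof.
have mg := @measurable_green R a.
apply: integrable_sqr_Lfun2 => //.
apply: (@ae_bounded_integrable _ _ _ circle circle_measure_lty _ 4).
  exact: measurable_funX.
apply: circle_aeW => u u01.
rewrite normrX (_ : 4 = 2 ^+ 2); last by rewrite expr2; ring.
by rewrite lerXn2r ?nnegrE// norm_green_le.
Qed.

Definition green_L2 : L2S R := Lfun_Sub (lee1n 2) green_Lfun.

Lemma green_L2E : (green_L2 : R -> R) = green a.
Proof. by []. Qed.

Lemma green_fcoef (n : int) : n != 0 ->
  let w := 2 * pi * n%:~R in
  fcoef green_L2 n = Complex ((cos (w * a) - 1) / w ^+ 2) (- sin (w * a) / w ^+ 2).
Proof.
move=> n0 w; have w0 : w != 0.
  by rewrite !mulf_neq0 ?intr_eq0// gt_eqF// pi_gt0.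
rewrite fcoefE green_L2E.
have [c0 s0] := cos_sin_2pi_int n 0.
have [c1 s1] := cos_sin_2pi_int n (pi / 2).
have e0 := green_fourier w0 a01 c0 s0.
(* The phase pi / 2 turns the cosine into minus the sine. *)
have e1 := green_fourier w0 a01 c1 s1.
congr Complex.
  rewrite cos0 addr0 in e0; rewrite -e0.
  by apply: eq_Rintegral => u _ /=; rewrite addr0.
rewrite cos_pihalf subr0 cosDpihalf in e1; rewrite -e1.
by apply: eq_Rintegral => u _ /=; rewrite cosDpihalf.
Qed.

Lemma green_fcoef0 : fcoef green_L2 0 = 0.
Proof.
rewrite fcoefE green_L2E.
have E (f : R -> R) (c : R) : (forall u, f u = c) ->
    \int[circle]_t (green a t * f t) = \int[circle]_t (c * green a t).
  by move=> fc; apply: eq_Rintegral => u _; rewrite fc mulrC.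
have I : circle.-integrable setT (EFin \o green a).
  apply: (@ae_bounded_integrable _ _ _ circle circle_measure_lty _ 2).
    exact: measurable_green.
  apply: circle_aeW => u u01.
  exact: norm_green_le.
rewrite (E _ 1); last by move=> u /=; rewrite mulr0 mul0r cos0.
rewrite (E _ 0); last by move=> u /=; rewrite mulr0 mul0r sin0 oppr0.
by rewrite !RintegralZl// green_mean0// !mulr0.
Qed.

(** |c_n|^2 <= 4 / (2 pi n)^4, so the n-th term of the energy is at most 1 / n^2. *)
Lemma green_H1_energy : (H1_energy green_L2 < +oo)%E.
Proof.
apply: le_lt_trans (@esum_int_inv_sqr_lty R); apply: le_esum => n _.
rewrite lee_fin; have [->|n0] := eqVneq n 0.
  by rewrite green_fcoef0 ComplexField.Normc.normc0 expr0n/= mul0r invr0.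
rewrite green_fcoef//= /ComplexField.Normc.normc sqr_sqrtr; last first.
  by rewrite addr_ge0// sqr_ge0.
set N := n%:~R : R.
have N1 : 1 <= N ^+ 2.
  rewrite -real_normK ?num_real// exprn_ege1//.
  by rewrite /N -intr_norm ler1z -gtz0_ge1 normr_gt0.
set c := cos _; set s := sin _.
(* Here pi >= 2 is precise enough. *)
have w2 : 16 * N ^+ 2 <= (2 * pi * N) ^+ 2.
  rewrite !exprMn ler_wpM2r ?sqr_ge0//.
  have := pi_ge2 R; set q := pi => q2; rewrite !expr2; nra.
have cs : c ^+ 2 + s ^+ 2 = 1 by exact: cos2Dsin2.
have c1 : -1 <= c by exact: cos_geN1.
set W := (2 * pi * N) ^+ 2 in w2 *.
have W0 : 0 < W by lra.
have -> : ((c - 1) / W) ^+ 2 + (- s / W) ^+ 2 = (2 - 2 * c) / W ^+ 2.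
  have -> : 2 - 2 * c = (c - 1) ^+ 2 + s ^+ 2 by rewrite sqrrB expr1n; lra.
  by field; rewrite gt_eqF.
rewrite -[X in _ <= X]div1r ler_pdivlMr; last lra.
rewrite mulrAC mulrA ler_pdivrMr; last exact: exprn_gt0.
rewrite mul1r.
move: w2 N1; set M := N ^+ 2 => w2 N1.
have MW : 16 * M * (16 * M) <= W ^+ 2 by rewrite expr2 ler_pM//; lra.
apply: le_trans MW.
have : M * M * (2 - 2 * c) <= M * M * 4 by rewrite ler_wpM2l//; [rewrite mulr_ge0//|]; lra.
have : 0 <= M * M by rewrite mulr_ge0//; lra.
lra.
Qed.

Lemma green_H10_proof : green_L2 \in H10_pred.
Proof. by rewrite inE; split; [exact: green_H1_energy|exact: green_fcoef0]. Qed.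

Definition green_H10 : H10 R := MkH10 green_H10_proof.

End green_sobolev.

Lemma H10_linE {R : realType} (c : R) (x y : H10 R) u :
  (c *: x + y : H10 R) u = c * x u + y u.
Proof. by []. Qed.

(** * Trapezoids approaching the indicator of an arc *)

Section trapezoids.
Context {R : realType}.
Notation circle := (@circle_measure R).

(** The width is proportional to t so that the two ramps fit into [0, t] for
    every index k; for t = 0 it is 0. *)
Definition ramp_width (t : R) (k : nat) : R := t / k.+2%:R.

Lemma ramp_width_bounds (t : R) k : 0 <= t -> 0 <= ramp_width t k <= t.
Proof.
by move=> t0; rewrite divr_ge0//= ler_pdivrMr// ler_peMr// ler1n.
Qed.

Lemma ramp_width_half (t : R) k : 0 <= t -> 2 * ramp_width t k <= t.
Proof.
by move=> t0; rewrite mulrA ler_pdivrMr// mulrC ler_wpM2l// ler_nat.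
Qed.

Lemma cvg_ramp_width (t : R) : ramp_width t k @[k --> \oo] --> (0 : R).
Proof.
rewrite -[X in _ --> X](mulr0 t); apply: cvgM; first exact: cvg_cst.
by have := @cvg_harmonic R; rewrite -(cvg_shiftS).
Qed.

Lemma ramp_width01 (t : R) k : 0 <= t <= 1 -> 0 <= ramp_width t k <= 1.
Proof.
move=> /andP[t0 t1]; have /andP[-> h] := ramp_width_bounds k t0.
exact: le_trans h t1.
Qed.

Lemma ramp_end01 (t : R) k : 0 <= t <= 1 -> 0 <= t - ramp_width t k <= 1.
Proof.
move=> /andP[t0 t1]; have /andP[h0 h1] := ramp_width_bounds k t0.
by apply/andP; split; lra.
Qed.

Variable t : R.
Hypothesis t01 : 0 <= t <= 1.

(** Minus its mean t - h, the function that rises from 0 to 1 on [0, h], falls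
    back to 0 on [t - h, t] and vanishes afterwards. Indeed h times its second
    derivative is delta_0 - delta_h - delta_(t - h) + delta_t, and this is what
    the three Green functions add up to. For t = 0 the scalar is the inverse of 0, so it is 0. *)
Definition trapezoid (k : nat) : H10 R := (ramp_width t k)^-1 *:
  (green_H10 (ramp_width01 k t01) + green_H10 (ramp_end01 k t01) - green_H10 t01).

Lemma trapezoidE k u : let h := ramp_width t k in
  trapezoid k u = h^-1 * (Num.min h u + Num.min (t - h) u - Num.min t u - h * (t - h)).
Proof.
move=> h; rewrite -[LHS]/(h^-1 * (green h u + green (t - h) u - green t u)) /green.
by congr (_ * _); field.
Qed.

Lemma trapezoid0 k u : t = 0 -> trapezoid k u = 0.
Proof. by move=> t0; rewrite trapezoidE {1}/ramp_width t0 mul0r invr0 mul0r. Qed.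

Lemma norm_trapezoid_le k u : 0 < u < 1 -> `|trapezoid k u| <= 1.
Proof.
move=> /andP[u0 u1]; have /andP[t0 t1] := t01.
have [te|tn0] := eqVneq t 0; first by rewrite trapezoid0// normr0.
have tp : 0 < t by rewrite lt_neqAle eq_sym tn0.
rewrite trapezoidE; set h := ramp_width t k.
have h0 : 0 < h by rewrite divr_gt0.
have ht : 2 * h <= t := ramp_width_half k t0.
rewrite normrM normfV (gtr0_norm h0) mulrC ler_pdivrMr// mul1r.
have hth : 0 <= h * (t - h) by rewrite mulr_ge0//; lra.
have hth1 : h * (t - h) <= h by rewrite ler_piMr//; lra.
rewrite ler_norml !minEle.
by do 3 (case: ifPn; rewrite -?ltNge => ?); apply/andP; split; lra.
Qed.

(** Off the ramps the trapezoid differs from the bridge function by its mean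
    alone, t - h instead of t, and every point of ]0, 1[ is eventually off the
    ramps. *)
Lemma cvg_trapezoid u : 0 < u < 1 -> trapezoid k u @[k --> \oo] --> bridge_fun t u.
Proof.
move=> /andP[u0 u1]; have /andP[t0 t1] := t01.
have [te|tn0] := eqVneq t 0.
  under eq_fun do rewrite trapezoid0//.
  rewrite /bridge_fun te indicE memNset; last first.
    by rewrite /= in_itv/= => /andP[x0 x1]; lra.
  by rewrite subr0; exact: cvg_cst.
have tp : 0 < t by rewrite lt_neqAle eq_sym tn0.
have lim : bridge_fun t u + ramp_width t k @[k --> \oo] --> bridge_fun t u.
  rewrite -[X in _ --> X]addr0; apply: cvgD; first exact: cvg_cst.
  exact: cvg_ramp_width.
apply: cvg_trans lim; apply: near_eq_cvg.
have [ut|ut] := ltP u t; near=> k; apply/esym.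
  have hu : ramp_width t k < u.
    by near: k; apply: (cvgr_lt _ (cvg_ramp_width t)).
  have hut : ramp_width t k < t - u.
    by near: k; apply: (cvgr_lt _ (cvg_ramp_width t)); rewrite subr_gt0.
  have h0 : 0 < ramp_width t k by rewrite divr_gt0.
  rewrite trapezoidE /bridge_fun indicE mem_set; last by rewrite /= in_itv/= ut ltW.
  rewrite (min_idPl (ltW hu)) (min_idPr (ltW ut)) min_r; last lra.
  by rewrite /=; field; rewrite gt_eqF.
have h0 : 0 < ramp_width t k by rewrite divr_gt0.
have ht : 2 * ramp_width t k <= t := ramp_width_half k t0.
rewrite trapezoidE /bridge_fun indicE memNset; last first.
  by rewrite /= in_itv/= => /andP[_]; rewrite ltNge ut.
rewrite (min_idPl ut) !min_l; try lra.
by rewrite /=; field; rewrite gt_eqF.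
Unshelve. all: by end_near.
Qed.

Lemma norm_bridge_fun_le u : `|bridge_fun t u| <= 1.
Proof.
have /andP[t0 t1] := t01.
by rewrite /bridge_fun indicE ler_norml; case: (_ \in _) => /=; lra.
Qed.

Lemma measurable_bridge_fun : measurable_fun setT (bridge_fun t).
Proof. by apply: measurable_funB => //; exact: measurable_indic. Qed.

(** Pointwise convergence and uniform bounds on a space of finite measure. *)
Lemma cvg_L2_trapezoid :
  ('N[circle]_2%:E[EFin \o (fun u => (trapezoid n u - bridge_fun t u)%R)]%E
    @[n --> \oo] --> 0%E).
Proof.
have mD n : measurable_fun setT (fun u => trapezoid n u - bridge_fun t u).
  by apply: measurable_funB; [exact: measurable_funPT|exact: measurable_bridge_fun].
have bD : {ae circle, forall u, forall n, `|(trapezoid n u - bridge_fun t u) ^+ 2| <= 4}.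
  apply: circle_aeW => u u01 n.
  rewrite normrX (_ : 4 = 2 ^+ 2); last by rewrite expr2; ring.
  rewrite lerXn2r ?nnegrE// (le_trans (ler_normB _ _))// -[2]/(1 + 1).
  by rewrite lerD ?norm_trapezoid_le ?norm_bridge_fun_le.
have ID n : circle.-integrable setT
    (EFin \o (fun u => (trapezoid n u - bridge_fun t u) ^+ 2)).
  apply: (@ae_bounded_integrable _ _ _ circle circle_measure_lty _ 4).
    exact: measurable_funX.
  by apply: (@filterS _ _ (ae_filter_ringOfSetsType circle) _ _ _ bD) => u /(_ n).
under eq_fun do rewrite Lnorm2E//.
apply: cvg_EFin; first exact: nearW.
rewrite -(@sqrtr0 R); apply: continuous_cvg; first exact: sqrt_continuous.
have lim : \int[circle]_u (trapezoid n u - bridge_fun t u) ^+ 2 @[n --> \oo] -->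
    \int[circle]_u cst 0 u.
  apply: (@cvg_Rintegral_bounded _ _ _ circle _ _ 4 circle_measure_lty) => //.
  - by move=> n; exact: measurable_funX.
  - apply: circle_aeW => u u01.
    have : trapezoid n u - bridge_fun t u @[n --> \oo] --> bridge_fun t u - bridge_fun t u.
      by apply: cvgB; [exact: cvg_trapezoid|exact: cvg_cst].
    by rewrite subrr => c; rewrite -[X in _ --> X](mulr0 0); exact: (cvgM c c).
by move: lim; rewrite Rintegral_cst// mul0r.
Qed.
End trapezoids.

(** * Inner products of the bridge functions *)

Section bridge_covariance.
Context {R : realType}.
Notation circle := (@circle_measure R).

Lemma integral_initial_arc (t : R) : 0 <= t <= 1 ->
  circle.-integrable setT (EFin \o \1_(`[0, t[ : set R)) /\
  \int[circle]_u \1_(`[0, t[) u = t.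
Proof.
move=> t01; split.
  apply: (@bounded_integrable _ _ _ circle circle_measure_lty _ 1) => // u.
  by rewrite indicE; case: (_ \in _); rewrite ?normr1 ?normr0.
rewrite /Rintegral integral_indic// setIT.
by rewrite [X in fine X](circle_measure_initial_arc t01).
Qed.

(** The product of the indicators of [0, s) and [0, t) is that of
    [0, min(s, t)), and the other terms of the expansion contribute - s t. *)
Lemma integral_bridge_fun_mul (s t : R) : 0 <= s <= 1 -> 0 <= t <= 1 ->
  \int[circle]_u (bridge_fun s u * bridge_fun t u) = Num.min s t - s * t.
Proof.
move=> s01 t01.
have m01 : 0 <= Num.min s t <= 1 by rewrite minEle; case: ifP.
have [Is Es] := integral_initial_arc s01.
have [It Et] := integral_initial_arc t01.
have [Im Em] := integral_initial_arc m01.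
have I1 : circle.-integrable setT (EFin \o cst (1 : R)).
  by apply: (@bounded_integrable _ _ _ circle circle_measure_lty _ 1) => // u; rewrite normr1.
have C1 : \int[circle]_u (1 : R) = 1.
  rewrite Rintegral_cst// mul1r.
  by rewrite circle_measureE setTI lebesgue_measure_itv/= lte_fin ltr01 sube0.
transitivity (\int[circle]_u (1 * (1 * \1_(`[0, Num.min s t[) u + - t * \1_(`[0, s[) u) +
    1 * (- s * \1_(`[0, t[) u + s * t * cst 1 u))).
  apply: eq_Rintegral => u _; rewrite /bridge_fun !indicE.
  have -> : (u \in `[0, Num.min s t[%classic) =
      (u \in `[0, s[%classic) && (u \in `[0, t[%classic).
    by rewrite !mem_setE !in_itv/= lt_min; case: (0 <= u).
  by do 2 case: (_ \in _) => /=; ring.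
rewrite !Rintegral_lin//.
- by rewrite Es Et Em C1; ring.
- exact: (integrableD measurableT (integrableZl measurableT _ Im)
    (integrableZl measurableT _ Is)).
- exact: (integrableD measurableT (integrableZl measurableT _ It)
    (integrableZl measurableT _ I1)).
Qed.

Lemma bridge_fun_Lfun (t : R) : 0 <= t <= 1 -> bridge_fun t \in Lfun circle 2%:E.
Proof.
move=> t01; have mb := @measurable_bridge_fun R t.
apply: integrable_sqr_Lfun2 => //.
apply: (@bounded_integrable _ _ _ circle circle_measure_lty _ 1).
  exact: measurable_funX.
by move=> u; rewrite normrX exprn_ile1// norm_bridge_fun_le.
Qed.
End bridge_covariance.

(** * Random variables in the closure of the white noise *)

Section white_noise_limits.
Context {R : realType}.
Variable mu : probability (whiteS R) R.
Hypothesis mu_white_noise : is_white_noise mu.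
Notation circle := (@circle_measure R).

(** Preimages are cylinders over a single test function. *)
Lemma measurable_pairing (xi : H10 R) :
  measurable_fun setT (fun x : whiteS R => pairing x xi).
Proof.
move=> _ B mB; rewrite setTI; apply: sub_sigma_algebra.
exists 1%N, [tuple of [:: xi]], [set v | B (tnth v ord0)]; split.
  rewrite -[X in measurable X]setTI.
  by apply: (measurable_tnth (ord0 : 'I_1)).
by apply/seteqP; split => x /=; rewrite tnth_map (tnth_nth xi).
Qed.

Lemma measurable_pairing_dist (xi : H10 R) (Y : whiteS R -> R) :
  measurable_fun setT Y ->
  measurable_fun setT (fun x : whiteS R => `|pairing x xi - Y x|%:E).
Proof.
move=> mY; apply/measurable_EFinP; apply: measurableT_comp => //.
by apply: measurable_funB => //; exact: measurable_pairing.
Qed.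

Lemma pairing_lin (c : R) (xi eta : H10 R) (x : Hm1 R) :
  pairing x (c *: xi + eta) = c * pairing x xi + pairing x eta.
Proof. by rewrite /pairing linearP. Qed.

Lemma l2norm_sqr (xi : H10 R) : l2norm xi ^+ 2 = \int[circle]_u xi u ^+ 2.
Proof.
rewrite /l2norm Lnorm2E/=; last by apply: Lfun2_integrable_sqr; exact: LfunP.
by rewrite sqr_sqrtr// Rintegral_ge0// => u _; exact: sqr_ge0.
Qed.

(** The defining property applied to s xi, split into real and imaginary parts. *)
Lemma white_noise_fourier (xi : H10 R) (s : R) :
  \int[mu]_x cos (s * pairing x xi) = expR (- (s ^+ 2 * \int[circle]_u xi u ^+ 2) / 2) /\
  \int[mu]_x sin (s * pairing x xi) = 0.
Proof.
have scale x : pairing x (s *: xi) = s * pairing x xi.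
  by have := pairing_lin s xi 0 x; rewrite addr0 => ->; rewrite /pairing linear0 addr0.
have := mu_white_noise (s *: xi); rewrite /cintegral l2norm_sqr.
have -> : \int[circle]_u (s *: xi : H10 R) u ^+ 2 = s ^+ 2 * \int[circle]_u xi u ^+ 2.
  rewrite -RintegralZl//; last by apply: Lfun2_integrable_sqr; exact: LfunP.
  by apply: eq_Rintegral => u _; rewrite -exprMn.
by case=> <- <-; split; apply: eq_Rintegral => x _ /=; rewrite scale.
Qed.

(** Y is a version of (g, x): g is approached by test functions in a way that
    controls both their norms and their pairings. Convergence in mean, rather
    than in square mean, suffices for characteristic functions; the integrals
    stay extended so that no integrability has to be checked beforehand. *)
Definition noise_limit (g : R -> R) (Y : whiteS R -> R) :=
  exists (eta : nat -> H10 R) (C : R),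
  [/\ measurable_fun setT g /\ measurable_fun setT Y,
      forall n u, 0 < u < 1 -> `|eta n u| <= C,
      forall u, 0 < u < 1 -> eta n u @[n --> \oo] --> g u &
      (\int[mu]_x `|pairing x (eta n) - Y x|%:E @[n --> \oo] --> 0)%E].

Lemma noise_limit0 : noise_limit (cst 0) (cst 0).
Proof.
exists (fun _ => 0), 0; split => //.
- by move=> n u _; rewrite normr0.
- by move=> u _; exact: cvg_cst.
- rewrite (_ : (fun n => _) = cst 0%E); first exact: cvg_cst.
  apply/funext => n; rewrite integral0_eq// => x _.
  by rewrite /pairing linear0 subrr normr0.
Qed.

Lemma noise_limit_lin (c : R) g Y g' Y' : noise_limit g Y -> noise_limit g' Y' ->
  noise_limit (fun u => c * g u + g' u) (fun x => c * Y x + Y' x).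
Proof.
move=> [eta [C [[mg mY] bnd cv lim]]] [eta' [C' [[mg' mY'] bnd' cv' lim']]].
exists (fun n => c *: eta n + eta' n), (`|c| * C + C'); split.
- by split; apply: measurable_funD => //; exact: measurable_funM.
- move=> n u u01; rewrite H10_linE (le_trans (ler_normD _ _))// normrM.
  by rewrite lerD ?ler_wpM2l ?bnd ?bnd'.
- move=> u u01; under eq_fun do rewrite H10_linE.
  by apply: cvgD; [apply: cvgM; [exact: cvg_cst|exact: cv]|exact: cv'].
- have upper : (`|c|%:E * (\int[mu]_x `|pairing x (eta n) - Y x|%:E) +
      \int[mu]_x `|pairing x (eta' n) - Y' x|%:E @[n --> \oo] --> 0)%E.
    rewrite -[X in _ --> X]adde0 -[X in (_ --> X + _)%E](mule0 `|c|%:E).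
    by apply: cvgeD => //; apply: cvgeZl.
  apply: (squeeze_cvge _ _ upper); last exact: cvg_cst.
  apply: nearW => n; apply/andP; split; first by rewrite integral_ge0.
  have mD := measurable_pairing_dist (eta n) mY.
  have mD' := measurable_pairing_dist (eta' n) mY'.
  rewrite -ge0_integralZl//.
  rewrite -ge0_integralD//; last exact: measurable_funeM.
  apply: ge0_le_integral => //.
  + by apply: measurable_pairing_dist; apply: measurable_funD => //; exact: measurable_funM.
  + by apply: emeasurable_funD => //; exact: measurable_funeM.
  + move=> x _; rewrite -EFinM -EFinD lee_fin pairing_lin -normrM.
    apply: le_trans (ler_normD _ _); rewrite le_eqVlt; apply/orP; left; apply/eqP.
    by congr `| _ |; ring.
Qed.

(** Cosine and sine are bounded and 1-Lipschitz, so their means pass to the limit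
    in L^1, while the variances converge by dominated convergence. *)
Lemma noise_limit_cf g Y : noise_limit g Y ->
  has_gaussian_cf mu (Num.sqrt (\int[circle]_u g u ^+ 2)) Y.
Proof.
move=> [eta [C [[mg mY] bnd cv lim]]] s.
rewrite sqr_sqrtr; last by apply: Rintegral_ge0 => u _; exact: sqr_ge0.
have norms : \int[circle]_u eta n u ^+ 2 @[n --> \oo] --> \int[circle]_u g u ^+ 2.
  apply: (@cvg_Rintegral_bounded _ _ _ circle _ _ (C ^+ 2) circle_measure_lty).
  - by move=> n; apply: measurable_funX; exact: measurable_funPT.
  - exact: measurable_funX.
  - apply: circle_aeW => u u01.
    by apply: cvgM; exact: cv.
  - apply: circle_aeW => u u01 n.
    by rewrite normrX lerXn2r ?nnegrE// ?bnd// (le_trans _ (bnd n u u01)).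
have mpair n := measurable_pairing (eta n).
have lipschitz (f : R -> R) : measurable_fun setT f -> (forall x, `|f x| <= 1) ->
    (forall x y, `|f x - f y| <= `|x - y|) ->
    \int[mu]_x f (s * pairing x (eta n)) @[n --> \oo] --> \int[mu]_x f (s * Y x).
  move=> mf f1 flip.
  have If (Z : whiteS R -> R) : measurable_fun setT Z ->
      mu.-integrable setT (EFin \o (fun x => f (s * Z x))).
    move=> mZ; apply: (@bounded_integrable _ _ _ mu (probability_lty mu) _ 1) => //.
    by apply: (measurableT_comp mf); exact: measurable_funM.
  have limR := fine_cvg lim.
  have fin := cvg_is_fine lim.
  apply: cvg_zero; apply: norm_cvg0.
  apply: (@squeeze_cvgr _ _ _ _ (cst 0)
    (fun n => `|s| * fine (\int[mu]_x `|pairing x (eta n) - Y x|%:E)%E)).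
  - near=> n; rewrite normr_ge0/=.
    have en : (\int[mu]_x `|pairing x (eta n) - Y x|%:E)%E \is a fin_num by near: n.
    have mD := measurable_pairing_dist (eta n) mY.
    have ID := integrableB measurableT (If _ (mpair n)) (If _ mY).
    rewrite -[X in `|X|]/(_ - _) -RintegralB ?If//.
    apply: (le_trans (le_normr_Rintegral measurableT ID)).
    rewrite -lee_fin EFinM (fineK en) -ge0_integralZl// /Rintegral fineK; last first.
      by apply: integrable_fin_num => //; exact: integrable_norm.
    apply: ge0_le_integral => //.
    + by case/integrableP : (integrable_norm ID).
    + exact: measurable_funeM.
    + move=> x _; rewrite -EFinM lee_fin (le_trans (flip _ _))//.
      by rewrite -mulrBr normrM.
  - exact: cvg_cst.
  - rewrite -[X in _ --> X](mulr0 `|s|); apply: cvgM; first exact: cvg_cst.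
    exact: limR.
have [hc hs] : (forall n, \int[mu]_x cos (s * pairing x (eta n)) =
    expR (- (s ^+ 2 * \int[circle]_u eta n u ^+ 2) / 2)) /\
    (forall n, \int[mu]_x sin (s * pairing x (eta n)) = 0).
  by split => n; have [] := white_noise_fourier (eta n) s.
split.
- have := lipschitz cos (continuous_measurable_fun (@continuous_cos R))
    (@cos_max R) (@ler_norm_sub_cos R).
  under eq_fun do rewrite hc.
  move=> limc; apply: (cvg_unique _ limc) => //.
  apply: continuous_cvg; first exact: continuous_expR.
  rewrite (mulrC (\int[circle]_u g u ^+ 2)).
  by apply: cvgM; [apply: cvgN; apply: cvgM => //; exact: cvg_cst|exact: cvg_cst].
- have := lipschitz sin (continuous_measurable_fun (@continuous_sin R))
    (@sin_max R) (@ler_norm_sub_sin R).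
  under eq_fun do rewrite hs.
  by move=> lims; apply: (cvg_unique _ lims) => //; exact: cvg_cst.
Unshelve. all: by end_near.
Qed.

(** On a probability space the L^1 norm is bounded by the L^2 norm, so the
    trapezoids are a sequence to which the hypothesis on X applies. *)
Lemma bridge_noise_limit (t : R) (X : {RV mu >-> R}) : 0 <= t <= 1 ->
  is_pairing (bridge_fun t) X -> noise_limit (bridge_fun t) X.
Proof.
move=> t01 [_ /(_ _ (cvg_L2_trapezoid t01)) lim].
exists (trapezoid t01), 1; split.
- by split; [exact: measurable_bridge_fun|exact: measurable_funPT].
- by move=> n u; exact: norm_trapezoid_le.
- by move=> u; exact: cvg_trapezoid.
apply: (squeeze_cvge _ _ lim); last exact: cvg_cst.
apply: nearW => n; apply/andP; split; first by rewrite integral_ge0.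
pose f x := pairing x (trapezoid t01 n) - X x.
have mf : @measurable_fun _ _ (whiteS R) R setT f.
  by apply: measurable_funB; [exact: measurable_pairing|exact: measurable_funPT].
have := @hoelder _ _ _ mu f (cst 1) 2 2 mf (measurable_cst _).
rewrite Lnorm_cst1 [X in (X `^ _)%E](probability_setT mu) poweR1r mule1 Lnorm1.
have -> : (2^-1 + 2^-1 = 1 :> R) by field.
move=> /(_ (ltr0n _ 2) (ltr0n _ 2) erefl); apply: le_trans.
by rewrite le_eqVlt; apply/orP; left; apply/eqP; apply: eq_integral => x _ /=; rewrite mulr1.
Qed.
End white_noise_limits.

Section white_noise_bridge.
Context {R : realType}.
Variable mu : probability (whiteS R) R.
Hypothesis mu_white_noise : is_white_noise mu.
Notation circle := (@circle_measure R).

Definition limit_of_noise (Y : {RV mu >-> R}) := exists g, noise_limit mu g Y.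

Lemma limit_of_noise_sum n (a : 'I_n -> R) (Y : 'I_n -> {RV mu >-> R}) :
  (forall i, limit_of_noise (Y i)) -> limit_of_noise (\sum_(i < n) a i *: Y i).
Proof.
move=> YL; elim/big_rec: _ => [|i Z _ [g gZ]].
  by exists (cst 0); exact: noise_limit0.
have [h hY] := YL i.
exists (fun u => a i * h u + g u).
have := noise_limit_lin (a i) hY gZ.
by congr noise_limit.
Qed.

Lemma limit_of_noise_gaussian (Y : {RV mu >-> R}) : limit_of_noise Y -> gaussian Y.
Proof.
move=> [g gY]; apply: has_gaussian_cf_gaussian.
exact: (noise_limit_cf mu_white_noise gY).
Qed.

Lemma noise_limit_second_moment g (Y : whiteS R -> R) :
  Y \in Lfun mu 2%:E -> noise_limit mu g Y ->
  \int[mu]_x Y x ^+ 2 = \int[circle]_u g u ^+ 2.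
Proof.
move=> Y2 gY; have [_ [_ [[_ mY] _ _ _]]] := gY.
rewrite (gaussian_cf_second_moment mY _ (noise_limit_cf mu_white_noise gY)).
  by rewrite sqr_sqrtr// Rintegral_ge0// => u _; exact: sqr_ge0.
exact: Lfun2_integrable_sqr.
Qed.

Lemma noise_limit_mean g (Y : whiteS R -> R) :
  Y \in Lfun mu 2%:E -> noise_limit mu g Y -> ('E_mu[Y] = 0)%E.
Proof.
move=> Y2 gY.
have Y1 : Y \in Lfun mu 1 by apply: Lfun_subset12 => //; rewrite fin_num_measure.
have IY : mu.-integrable setT (EFin \o Y) by apply/Lfun1_integrable.
rewrite unlock -[LHS]fineK; last exact: integrable_fin_num.
by rewrite -/(Rintegral _ _ _) (gaussian_cf_mean IY (noise_limit_cf mu_white_noise gY)).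
Qed.

(** The variances of Y, Z and Y + Z are the square norms of g, h and g + h;
    polarizing both sides identifies the mixed terms. *)
Lemma noise_limit_covariance g h (Y Z : whiteS R -> R) :
  g \in Lfun circle 2%:E -> h \in Lfun circle 2%:E ->
  Y \in Lfun mu 2%:E -> Z \in Lfun mu 2%:E ->
  noise_limit mu g Y -> noise_limit mu h Z ->
  covariance mu Y Z = (\int[circle]_u (g u * h u))%:E.
Proof.
move=> g2 h2 Y2 Z2 gY hZ.
have muT : mu setT \is a fin_num by rewrite fin_num_measure.
have YZ1 := Lfun2_mul_Lfun1 Y2 Z2.
rewrite covarianceE; [|exact: Lfun_subset12..|exact: YZ1].
rewrite (noise_limit_mean Y2 gY) mul0e sube0.
rewrite unlock -[LHS]fineK; last first.
  by apply: integrable_fin_num => //; exact/Lfun1_integrable.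
congr EFin; rewrite -[LHS]/(\int[mu]_x (Y x * Z x)).
have YZ2 : (fun x => Y x + Z x) \in Lfun mu 2%:E.
  exact: (Lfun_addr_closed mu (lee1n 2)).2.
have ghYZ : noise_limit mu (fun u => g u + h u) (fun x => Y x + Z x).
  have := noise_limit_lin 1 gY hZ; congr noise_limit.
    by apply/funext => u; rewrite mul1r.
  by apply/funext => u; rewrite mul1r.
have := noise_limit_second_moment YZ2 ghYZ.
rewrite !Rintegral_sqrD// (noise_limit_second_moment Y2 gY) (noise_limit_second_moment Z2 hZ).
by move=> /addIr/addrI/mulfI; apply; rewrite pnatr_eq0.
Qed.
End white_noise_bridge.

Theorem theorem7 (R : realType) (mu : probability (whiteS R) R)
    (mu_white_noise : is_white_noise mu)
    (X : R -> {RV mu >-> R})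
    (X_pairing : forall t, t \in `[0, 1] -> is_pairing (bridge_fun t) (X t)) :
  brownian_bridge X.
Proof.
have I01 (t : R) : t \in `[0, 1] -> 0 <= t <= 1 by rewrite in_itv/=.
have noise (t : R) : t \in `[0, 1] -> noise_limit mu (bridge_fun t) (X t).
  by move=> t01; apply: bridge_noise_limit; [exact: I01 t01|exact: X_pairing t01].
have X2 (t : R) : t \in `[0, 1] -> (X t : whiteS R -> R) \in Lfun mu 2%:E.
  by move=> /X_pairing[].
split.
- move=> n t a t01; apply: limit_of_noise_gaussian => //.
  by apply: limit_of_noise_sum => i; exists (bridge_fun (t i)); exact: noise (t01 i).
- by move=> t t01; apply: (noise_limit_mean _ _ (noise t t01)) => //; exact: X2.
- move=> s t s01 t01.
  rewrite (noise_limit_covariance mu_white_noise _ _ (X2 s s01) (X2 t t01)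
    (noise s s01) (noise t t01)).
  + by rewrite integral_bridge_fun_mul ?I01.
  + by apply: bridge_fun_Lfun; exact: I01.
  + by apply: bridge_fun_Lfun; exact: I01.
Qed.
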